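(* Assume $W_c$ satisfies Assumption 1, let $r>0$, and suppose \[rH^{W_s}(M)+H^{W_c}(X|Z)<R<rH^{W_s}_0(M)+H^{W_c,\downarrow}_0(X|Z).\] Let $U:=U[W_s,W_c,\downarrow;r]$ and let $\theta_0\in(0,1)$ satisfy $(1-\theta_0)U'(\theta_0)+U(\theta_0)=R$. Then \[ \limsup_{n\to\infty}-\frac1n\log P_j(\lfloor rn\rfloor,n)\le\theta_0U'(\theta_0)-U(\theta_0)=\sup_{\theta<1}\frac{\theta R-U(\theta)}{1-\theta}. \]
   Context: Setup. $\mathcal M$ finite, $W_s$ an irreducible aperiodic transition matrix on $\mathcal M$; message $M^k$ with law $P_{M_1}(m_1)\prod_{i=2}^kW_s(m_i|m_{i-1})$. $\mathcal X$ a finite abelian group, $\mathcal Z$ finite, $W_c=\{W_c(x,z|x',z')\}$ an irreducible aperiodic transition matrix on $\mathcal X\times\mathcal Z$; noise $(X^n,Z^n)$ with law $P_{X_1Z_1}(x_1,z_1)\prod_{i=2}^nW_c(x_i,z_i|x_{i-1},z_{i-1})$. Channel: input $\tilde x^n$ yields output $(x^n,z^n)$ with probability $P_{X^nZ^n}(x^n-\tilde x^n,z^n)$. $P_j(k,n)$ is the minimum over codes $(\mathsf e:\mathcal M^k\to\mathcal X^n,\ \mathsf d:(\mathcal X\times\mathcal Z)^n\to\mathcal M^k)$ of the average decoding error probability. $R:=\log|\mathcal X|$. Assumption 1: $\sum_xW_c(x,z|x',z')$ does not depend on $x'$; call it $W_{c,Z}(z|z')$. Entrywise powers $a^t$ of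 transition probabilities are $0$ when $a=0$; $\lambda(A)$ denotes the Perron–Frobenius eigenvalue. $\theta H^{W_s}_{1-\theta}(M):=\log\lambda\big(W_s(m|m')^{1-\theta}\big)$, $\theta H^{W_c,\downarrow}_{1-\theta}(X|Z):=\log\lambda\big(W_c(x,z|x',z')^{1-\theta}W_{c,Z}(z|z')^{\theta}\big)$; $H^{W_s}(M)$, $H^{W_c}(X|Z)$ are the limits as $\theta\to0$, and $H^{W_s}_0(M)$, $H^{W_c,\downarrow}_0(X|Z)$ the values at $\theta=1$. $U[W_s,W_c,\downarrow;r](\theta):=r\theta H^{W_s}_{1-\theta}(M)+\theta H^{W_c,\downarrow}_{1-\theta}(X|Z)$. *)

(* Defs.v *)
From HB Require Import structures.
From mathcomp Require Import all_boot all_algebra.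
From Stdlib Require Import Reals ZArith ClassicalEpsilon.
Set Implicit Arguments. Unset Strict Implicit. Unset Printing Implicit Defensive.

Local Open Scope R_scope.

Definition fsum (T : finType) (f : T -> R) : R := \big[Rplus/0]_(i : T) f i.

Definition rpow0 (a t : R) : R := if Rlt_dec 0 a then Rpower a t else 0.

(* transition matrix W : T -> T -> R, W x x' = W(x | x') *)
Definition stochastic (T : finType) (W : T -> T -> R) : Prop :=
  (forall x x', 0 <= W x x') /\ (forall x', fsum (fun x => W x x') = 1).

Definition distribution (T : finType) (P : T -> R) : Prop :=
  (forall x, 0 <= P x) /\ fsum P = 1.

Fixpoint matpow (T : finType) (W : T -> T -> R) (n : nat) : T -> T -> R :=
  match n with
  | O => fun x x' => if x == x' then 1 else 0
  | S k => fun x x' => fsum (fun y => W x y * matpow W k y x')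
  end.

Definition irreducible (T : finType) (W : T -> T -> R) : Prop :=
  forall x x', exists n, (0 < n)%nat /\ 0 < matpow W n x x'.

Definition aperiodic (T : finType) (W : T -> T -> R) : Prop :=
  forall x d, (forall n, (0 < n)%nat -> 0 < matpow W n x x -> (d %| n)%N) -> d = 1%nat.

(* Perron-Frobenius eigenvalue of a nonnegative irreducible matrix: the
   (unique) eigenvalue having an entrywise positive eigenvector. *)
Definition PFeig (T : finType) (A : T -> T -> R) : R :=
  epsilon (inhabits 0) (fun rho => exists v : T -> R,
     (forall i, 0 < v i) /\ forall i, fsum (fun j => A i j * v j) = rho * v i).

Definition lim0 (f : R -> R) : R :=
  epsilon (inhabits 0) (fun l => limit1_in f (fun t => t <> 0) l 0).

Fixpoint chain_prob (T : finType) (W : T -> T -> R) (prev : T) (s : seq T) : R :=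
  match s with
  | [::] => 1
  | x :: s' => W x prev * chain_prob W x s'
  end.

Definition markov_prob (T : finType) (P1 : T -> R) (W : T -> T -> R) (s : seq T) : R :=
  match s with
  | [::] => 1
  | x :: s' => P1 x * chain_prob W x s'
  end.

Definition WcZ (X : finZmodType) (Z : finType) (Wc : (X * Z)%type -> (X * Z)%type -> R)
  (z z' : Z) : R := fsum (fun x : X => Wc (x, z) (GRing.zero : X, z')).

Definition assumption1 (X : finZmodType) (Z : finType)
  (Wc : (X * Z)%type -> (X * Z)%type -> R) : Prop :=
  forall z z' x1 x2, fsum (fun x : X => Wc (x, z) (x1, z')) = fsum (fun x : X => Wc (x, z) (x2, z')).

Definition thetaHs (M : finType) (Ws : M -> M -> R) (theta : R) : R :=
  ln (PFeig (fun m m' => rpow0 (Ws m m') (1 - theta))).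

Definition thetaHc (X : finZmodType) (Z : finType)
  (Wc : (X * Z)%type -> (X * Z)%type -> R) (theta : R) : R :=
  ln (PFeig (fun p p' => rpow0 (Wc p p') (1 - theta) * rpow0 (WcZ Wc p.2 p'.2) theta)).

Definition Hs (M : finType) (Ws : M -> M -> R) : R := lim0 (fun t => thetaHs Ws t / t).
Definition Hc (X : finZmodType) (Z : finType) (Wc : (X * Z)%type -> (X * Z)%type -> R) : R :=
  lim0 (fun t => thetaHc Wc t / t).
Definition Hs0 (M : finType) (Ws : M -> M -> R) : R := thetaHs Ws 1.
Definition Hc0 (X : finZmodType) (Z : finType) (Wc : (X * Z)%type -> (X * Z)%type -> R) : R :=
  thetaHc Wc 1.

Definition Ufun (M : finType) (X : finZmodType) (Z : finType) (Ws : M -> M -> R)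
  (Wc : (X * Z)%type -> (X * Z)%type -> R) (r : R) (theta : R) : R :=
  r * thetaHs Ws theta + thetaHc Wc theta.

Definition noise_of (X : finZmodType) (Z : finType) (n : nat)
  (y : n.-tuple (X * Z)) (xt : n.-tuple X) : seq (X * Z) :=
  map (fun p : (X * Z) * X => (GRing.add p.1.1 (GRing.opp p.2), p.1.2)) (zip y xt).

Definition code_error (M : finType) (X : finZmodType) (Z : finType)
  (PM1 : M -> R) (Ws : M -> M -> R) (PXZ1 : (X * Z)%type -> R)
  (Wc : (X * Z)%type -> (X * Z)%type -> R) (k n : nat)
  (e : k.-tuple M -> n.-tuple X) (d : n.-tuple (X * Z) -> k.-tuple M) : R :=
  fsum (fun m : k.-tuple M =>
    fsum (fun y : n.-tuple (X * Z) =>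
      markov_prob PM1 Ws m * markov_prob PXZ1 Wc (noise_of y (e m))
      * (if d y == m then 0 else 1))).

Definition Pj (M : finType) (X : finZmodType) (Z : finType)
  (PM1 : M -> R) (Ws : M -> M -> R) (PXZ1 : (X * Z)%type -> R)
  (Wc : (X * Z)%type -> (X * Z)%type -> R) (k n : nat) : R :=
  epsilon (inhabits 0) (fun p =>
    (exists e d, code_error PM1 Ws PXZ1 Wc (k:=k) (n:=n) e d = p) /\
    (forall e d, p <= code_error PM1 Ws PXZ1 Wc (k:=k) (n:=n) e d)).

Definition floorR (x : R) : nat := Z.to_nat (Int_part x).

(* Main.v *)
Require Import Defs.
From HB Require Import structures.
From mathcomp Require Import all_boot all_algebra.
From Stdlib Require Import Reals ZArith ClassicalEpsilon.
From Stdlib Require Import Lra FunctionalExtensionality.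
Set Implicit Arguments. Unset Strict Implicit. Unset Printing Implicit Defensive.

Local Open Scope R_scope.

(** The information density of a message and a noise word is additive along
    transitions, so tilting the joint law by [exp (theta * density)] replaces the
    transition matrices by the tilted ones, and the total tilted weight is
    [exp (n * U theta)] up to constants, by Perron-Frobenius. For a code, discard
    from the law tilted at [theta] the words whose density is outside
    [[n * a, n * b]] (exponential Chebyshev, at the cost of the weights at
    [theta - s] and [theta + s]) and the correctly decoded words (each output is
    decoded to one message, so their weight at the tilt 1 is at most about
    [#|X| ^ n]). What remains is made of decoding errors, and untilting it costs at
    most [exp (theta * n * b)]. Taking [theta] slightly above [theta0] makes every
    discarded part exponentially negligible, provided [U] lies strictly above its
    tangent at [theta0]; this holds because a logarithmic Perron-Frobenius
    eigenvalue that is not strictly convex is affine, which would contradict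
    [ln #|X| < U 1]. *)

(** * Finite sums and sequences of reals *)

HB.instance Definition _ := Monoid.isComLaw.Build R 0 Rplus
  (fun x y z => esym (Rplus_assoc x y z)) Rplus_comm Rplus_0_l.
HB.instance Definition _ := Monoid.isMulLaw.Build R 0 Rmult Rmult_0_l Rmult_0_r.
HB.instance Definition _ := Monoid.isAddLaw.Build R Rmult Rplus
  Rmult_plus_distr_r Rmult_plus_distr_l.

Lemma Un_cv_const c : Un_cv (fun _ => c) c.
Proof. by move=> e e0; exists 0%nat => n _; rewrite Rdist_eq. Qed.

Lemma inv_INR_cv : Un_cv (fun n => / INR n.+1) 0.
Proof. by apply: Un_cv_ext RinvN_cv => n; rewrite S_INR. Qed.

Lemma inv_INR_gt0 n : 0 < / INR n.+1.
Proof. by apply: Rinv_0_lt_compat; apply: lt_0_INR; apply/ltP. Qed.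

Section FiniteSums.

Variable T : finType.
Implicit Types f g : T -> R.

Lemma fsum_eq f g : (forall i, f i = g i) -> fsum f = fsum g.
Proof. by move=> fg; apply: eq_bigr => i _; apply: fg. Qed.

Lemma fsumD f g : fsum (fun i => f i + g i) = fsum f + fsum g.
Proof. exact: big_split. Qed.

Lemma fsumMl c f : fsum (fun i => c * f i) = c * fsum f.
Proof. by rewrite /fsum big_distrr. Qed.

Lemma fsumMr c f : fsum (fun i => f i * c) = fsum f * c.
Proof. by rewrite /fsum big_distrl. Qed.

Lemma fsumB f g : fsum (fun i => f i - g i) = fsum f - fsum g.
Proof.
have -> : fsum f - fsum g = fsum f + -1 * fsum g by lra.
by rewrite -fsumMl -fsumD; apply: fsum_eq => i; lra.
Qed.

Lemma fsum_le f g : (forall i, f i <= g i) -> fsum f <= fsum g.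
Proof.
move=> fg; rewrite /fsum; apply: (big_ind2 Rle) => //; first exact: Rle_refl.
by move=> *; apply: Rplus_le_compat.
Qed.

Lemma fsum_ge0 f : (forall i, 0 <= f i) -> 0 <= fsum f.
Proof.
move=> f0; rewrite /fsum; apply: big_ind => //; first exact: Rle_refl.
by move=> *; apply: Rplus_le_le_0_compat.
Qed.

Lemma fsum_ge_term f i : (forall j, 0 <= f j) -> f i <= fsum f.
Proof.
move=> f0; rewrite /fsum (bigD1 i) //= -[X in X <= _]Rplus_0_r.
apply: Rplus_le_compat_l; apply: big_ind => //; first exact: Rle_refl.
by move=> *; apply: Rplus_le_le_0_compat.
Qed.

Lemma fsum_gt0 f i : (forall j, 0 <= f j) -> 0 < f i -> 0 < fsum f.
Proof. by move=> f0 fi; apply: (Rlt_le_trans _ (f i)) => //; apply: fsum_ge_term. Qed.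

Lemma fsum_gt0_ex f : (forall j, 0 <= f j) -> 0 < fsum f -> exists i, 0 < f i.
Proof.
move=> f0 fp; apply: NNPP => nex.
have : fsum f <= 0.
  rewrite /fsum; apply: (big_ind (fun x => x <= 0)); first exact: Rle_refl.
    by move=> x y; lra.
  by move=> i _; apply: Rnot_lt_le => fi; apply: nex; exists i.
by lra.
Qed.

Lemma fsum_le_eq f g : (forall i, f i <= g i) -> fsum f = fsum g ->
  forall i, f i = g i.
Proof.
move=> fg eqs i; apply: NNPP => ne.
have h0 j : 0 <= g j - f j by move: (fg j); lra.
have : 0 < fsum (fun j => g j - f j).
  by apply: (@fsum_gt0 _ i) => //; move: (h0 i); lra.
by rewrite fsumB; lra.
Qed.

Lemma fsum_exchange (S : finType) (f : T -> S -> R) :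
  fsum (fun i => fsum (fun j => f i j)) = fsum (fun j => fsum (fun i => f i j)).
Proof. exact: exchange_big. Qed.

Lemma fsum_pair (S : finType) (f : T -> S -> R) :
  fsum (fun i => fsum (f i)) = fsum (fun p => f p.1 p.2).
Proof. exact: pair_bigA. Qed.

Lemma fsum_bij (S : finType) (h : S -> T) f : bijective h ->
  fsum (fun j => f (h j)) = fsum f.
Proof. by move=> hb; rewrite /fsum [RHS](reindex h) //; apply: onW_bij. Qed.

Lemma fsum_pred1 f i : fsum (fun j => if i == j then f j else 0) = f i.
Proof.
rewrite /fsum (bigD1 i) //= eqxx big1 ?Rplus_0_r // => j.
by rewrite eq_sym => /negbTE ->.
Qed.

Lemma fsum_const c : fsum (fun _ : T => c) = INR #|T| * c.
Proof.
rewrite /fsum big_const; elim: #|_| => [|n IH]; first by rewrite /=; lra.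
by rewrite iterS IH S_INR; lra.
Qed.

Lemma fsum_cv (u : nat -> T -> R) (l : T -> R) :
  (forall i, Un_cv (fun n => u n i) (l i)) -> Un_cv (fun n => fsum (u n)) (fsum l).
Proof.
move=> ul; rewrite /fsum; elim: (index_enum T) => [|i s IH].
  rewrite big_nil; apply: (Un_cv_ext (fun _ => 0)); first by move=> n; rewrite big_nil.
  exact: Un_cv_const.
rewrite big_cons; apply: (Un_cv_ext (fun n => u n i + \big[Rplus/0]_(j <- s) u n j)).
  by move=> n; rewrite big_cons.
exact: CV_plus.
Qed.

Lemma ex_argmax (t0 : T) f : exists t, forall t', f t' <= f t.
Proof.
suff H : forall s : seq T, exists t, forall t', t' \in s -> f t' <= f t.
  by have [t Ht] := H (enum T); exists t => t'; apply: Ht; rewrite mem_enum.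
elim=> [|a s [t Ht]]; first by exists t0.
case: (Rle_dec (f a) (f t)) => at_.
  by exists t => t'; rewrite inE => /orP[/eqP ->|/Ht].
exists a => t'; rewrite inE => /orP[/eqP ->|/Ht]; lra.
Qed.

Lemma ex_argmin (t0 : T) f : exists t, forall t', f t <= f t'.
Proof.
by have [t Ht] := ex_argmax t0 (fun t => - f t); exists t => t'; move: (Ht t'); lra.
Qed.

End FiniteSums.

(** * Perron-Frobenius eigenvectors *)

(** Bolzano-Weierstrass is applied to one coordinate at a time, refining the extraction each time.
    [n <= phi n] replaces strict monotonicity: it is enough to preserve limits. *)
Lemma cluster_vector (T : finType) (u : nat -> T -> R) :
  (forall n i, 0 <= u n i <= 1) ->
  exists (phi : nat -> nat) (l : T -> R), (forall n, (n <= phi n)%nat) /\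
    forall i, Un_cv (fun n => u (phi n) i) (l i).
Proof.
move=> ub.
suff [phi [l [phi_ge cv]]] : exists (phi : nat -> nat) (l : T -> R),
    (forall n, (n <= phi n)%nat) /\
    forall i, i \in enum T -> Un_cv (fun n => u (phi n) i) (l i).
  by exists phi, l; split=> // i; apply: cv; rewrite mem_enum.
elim: (enum T) => [|a s [phi [l [phi_ge cv]]]]; first by exists (fun n => n), (fun _ => 0).
have [x adh] := @Bolzano_Weierstrass (fun n => u (phi n) a) _ (compact_P3 0 1)
  (fun n => ub (phi n) a).
have step n : exists p, (n <= p)%nat /\ Rabs (u (phi p) a - x) < / INR n.+1.
  have [|p [/leP np H]] := adh (fun y => Rabs (y - x) < / INR n.+1) n.
    by exists (mkposreal _ (inv_INR_gt0 n)) => y.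
  by exists p.
pose psi n := proj1_sig (constructive_indefinite_description _ (step n)).
have psi_ge n : (n <= psi n)%nat.
  by rewrite /psi; case: constructive_indefinite_description => p [].
have psi_x n : Rabs (u (phi (psi n)) a - x) < / INR n.+1.
  by rewrite /psi; case: constructive_indefinite_description => p [].
exists (fun n => phi (psi n)), (fun i => if i == a then x else l i); split.
  by move=> n; apply: (leq_trans (psi_ge n)).
move=> i; rewrite inE; case: eqP => [-> _|_ /= si] e e0.
  have [N HN] := inv_INR_cv e0; exists N => n Nn; apply: (Rlt_trans _ _ _ (psi_x n)).
  move: (HN n Nn); rewrite /Rdist Rminus_0_r Rabs_pos_eq //.
  exact/Rlt_le/inv_INR_gt0.
have [N HN] := cv i si e e0; exists N => n /leP Nn; apply: HN.
by apply/leP; apply: leq_trans Nn (psi_ge n).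
Qed.

(* Irreducibility phrased without matrix powers: no proper nonempty set of indices
   is closed under the arrows [j -> i] with [0 < A i j]. Unlike [irreducible], it
   holds for the zero matrix of size one. *)
Definition connected_mx (T : finType) (A : T -> T -> R) : Prop :=
  (forall i j, 0 <= A i j) /\
  forall P : T -> Prop, (exists i, P i) ->
    (forall i j, 0 < A i j -> P j -> P i) -> forall i, P i.

Definition mxvec_mul (T : finType) (A : T -> T -> R) (v : T -> R) (i : T) : R :=
  fsum (fun j => A i j * v j).

Section Perron.

Variables (T : finType) (A : T -> T -> R).
Hypothesis A_conn : connected_mx A.

Let A_ge0 i j : 0 <= A i j := A_conn.1 i j.

(** The shift [1 + A]: unlike [A] itself, it never shrinks the support of a nonnegative vector, so
    no aperiodicity is required below. *)
Let B (w : T -> R) i := w i + mxvec_mul A w i.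

Lemma mxvec_mul_ge0 w : (forall i, 0 <= w i) -> forall i, 0 <= mxvec_mul A w i.
Proof. by move=> w0 i; apply: fsum_ge0 => j; apply: Rmult_le_pos. Qed.

(** Induction on the number of zero entries. If the support is not everything, connectedness yields
    an arrow leaving it, and one application of [B] makes a new entry positive. *)
Lemma iter_shift_gt0 w : (forall i, 0 <= w i) -> (exists i, 0 < w i) ->
  exists n, forall i, 0 < ssrnat.iter n B w i.
Proof.
have [k] := ubnP #|[pred i | ~~ (if Rlt_dec 0 (w i) then true else false)]|.
elim: k w => // k IH w ltk w0 [i0 wi0].
have Bge i : w i <= B w i by move: (mxvec_mul_ge0 w0 i); rewrite /B; lra.
case: (classic (forall i, 0 < w i)) => [wp|]; first by exists 0%nat.
move=> /not_all_ex_not [i1 wi1].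
have [i2 [nwi2 Bi2]] : exists i, ~ 0 < w i /\ 0 < B w i.
  apply: NNPP => nex; apply: wi1; apply: (A_conn.2 (fun i => 0 < w i)); first by exists i0.
  move=> i j Aij wj; apply: NNPP => wi; apply: nex; exists i; split=> //.
  rewrite /B; suff : 0 < mxvec_mul A w i by move: (w0 i); lra.
  apply: (@fsum_gt0 _ _ j) => [l|]; first exact: Rmult_le_pos.
  exact: Rmult_lt_0_compat.
have [| | |n Hn] := IH (B w).
- rewrite -ltnS; apply: leq_trans ltk; rewrite ltnS; apply: proper_card; apply/properP; split.
    apply/subsetP => i; rewrite !inE; case: Rlt_dec => //= Bi.
    by case: Rlt_dec => //= wi; move: (Bge i); lra.
  by exists i2; rewrite !inE; case: Rlt_dec.
- by move=> i; apply: Rle_trans (w0 i) (Bge i).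
- by exists i0; apply: Rlt_le_trans wi0 (Bge i0).
by exists n.+1 => i; rewrite iterSr.
Qed.

Lemma mxvec_mul_lin a b v w i :
  mxvec_mul A (fun j => a * v j + b * w j) i = a * mxvec_mul A v i + b * mxvec_mul A w i.
Proof. by rewrite /mxvec_mul -!fsumMl -fsumD; apply: fsum_eq => j; ring. Qed.

Lemma mxvec_mul_eq v w i : (forall j, v j = w j) -> mxvec_mul A v i = mxvec_mul A w i.
Proof. by move=> vw; apply: fsum_eq => j; rewrite vw. Qed.

(** [B] is a polynomial in [A], hence commutes with [A - rho]. *)
Lemma iter_shift_defect rho x w n i :
  (forall j, w j = mxvec_mul A x j - rho * x j) ->
  ssrnat.iter n B w i = mxvec_mul A (ssrnat.iter n B x) i - rho * ssrnat.iter n B x i.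
Proof.
move=> defw; elim: n i => [|n IH] i //=.
have comm : mxvec_mul A (B (ssrnat.iter n B x)) i =
    1 * mxvec_mul A (ssrnat.iter n B x) i + 1 * mxvec_mul A (mxvec_mul A (ssrnat.iter n B x)) i.
  by rewrite -mxvec_mul_lin; apply: mxvec_mul_eq => j; rewrite /B; ring.
have eqw : mxvec_mul A (ssrnat.iter n B w) i =
    1 * mxvec_mul A (mxvec_mul A (ssrnat.iter n B x)) i + - rho * mxvec_mul A (ssrnat.iter n B x) i.
  by rewrite -mxvec_mul_lin; apply: mxvec_mul_eq => j; rewrite IH; ring.
by rewrite comm {1}/B eqw IH /B; ring.
Qed.

Lemma iter_shift_ge0 w n : (forall i, 0 <= w i) -> forall i, 0 <= ssrnat.iter n B w i.
Proof.
move=> w0; elim: n => [|n IH] i //=.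
by rewrite /B; apply: Rplus_le_le_0_compat => //; apply: mxvec_mul_ge0.
Qed.

Lemma iter_shift_eigen rho x n i : (forall j, mxvec_mul A x j = rho * x j) ->
  ssrnat.iter n B x i = (1 + rho) ^ n * x i.
Proof.
move=> ev; elim: n i => [|n IH] i /=; first by ring.
rewrite /B IH (mxvec_mul_eq (w := fun j => (1 + rho) ^ n * x j + 0 * x j)); last first.
  by move=> j; rewrite IH; ring.
by rewrite mxvec_mul_lin ev; ring.
Qed.

(** Powers of [B] act on an eigenvector by positive scalars, so the positivity they create was
    already there. *)
Lemma eigenvector_gt0 rho x : 0 <= rho -> (forall i, 0 <= x i) -> (exists i, 0 < x i) ->
  (forall j, mxvec_mul A x j = rho * x j) -> forall i, 0 < x i.
Proof.
move=> rho0 x0 xp ev i; have [n Hn] := iter_shift_gt0 x0 xp.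
move: (Hn i) (pow_lt (1 + rho) n); rewrite (iter_shift_eigen _ _ ev) => H1 H2.
case: (x0 i) => // xi; move: H1; rewrite -xi; lra.
Qed.

(** The Collatz-Wielandt condition, whose largest [t] is the Perron root. *)
Let feasible (t : R) (x : T -> R) :=
  [/\ forall i, 0 <= x i, fsum x = 1 & forall i, t * x i <= mxvec_mul A x i].

(** The supremum [rho] of the feasible values is attained, by compactness of the simplex, and
    maximality forces the maximizer to be an eigenvector. *)
Lemma perron_exists (t0 : T) :
  exists rho v, (forall i, 0 < v i) /\ forall i, mxvec_mul A v i = rho * v i.
Proof.
(* The sum of all entries bounds every feasible [t], since the entries of a normalized [x] are at
   most 1. *)
pose K := fsum (fun i => fsum (fun j => A i j)).
have x_le1 (x : T -> R) : (forall i, 0 <= x i) -> fsum x = 1 -> forall i, 0 <= x i <= 1.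
  by move=> x0 x1 i; split=> //; rewrite -x1; apply: fsum_ge_term.
have f_bound : bound (fun t => exists x, feasible t x).
  exists K => t [x [x0 x1 xt]].
  have -> : t = fsum (fun i => t * x i) by rewrite fsumMl x1; ring.
  apply: (Rle_trans _ (fsum (fun i => mxvec_mul A x i))); first exact: fsum_le.
  apply: fsum_le => i; apply: fsum_le => j; rewrite -[X in _ <= X]Rmult_1_r.
  by apply: Rmult_le_compat_l => //; case: (x_le1 x x0 x1 j).
have INRT : 0 < INR #|T|.
  by apply: lt_0_INR; apply/ltP; apply/card_gt0P; exists t0.
have f_0 : exists x, feasible 0 x.
  exists (fun _ => / INR #|T|).
  have h0 : 0 <= / INR #|T| by apply: Rlt_le; apply: Rinv_0_lt_compat.
  split=> // [|i]; first by rewrite fsum_const; apply: Rinv_r; lra.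
  by rewrite Rmult_0_l; apply: mxvec_mul_ge0.
have [rho [rho_ub rho_lub]] :=
  completeness _ f_bound (ex_intro _ 0 f_0).
have rho0 : 0 <= rho by apply: rho_ub.
have ex_n n : exists x, feasible (rho - / INR n.+1) x.
  apply: NNPP => nex.
  have n1 := inv_INR_gt0 n.
  suff : rho <= rho - / INR n.+1 by lra.
  apply: rho_lub => t [x [x0 x1 xt]]; apply: Rnot_lt_le => lt_t.
  apply: nex; exists x; split=> // i; apply: Rle_trans (xt i).
  by apply: Rmult_le_compat_r => //; lra.
pose u n := proj1_sig (constructive_indefinite_description _ (ex_n n)).
have uP n : feasible (rho - / INR n.+1) (u n).
  by rewrite /u; case: constructive_indefinite_description.
have [|phi [x [phi_ge cv]]] := @cluster_vector T u.
  by move=> n; case: (uP n) => h0 h1 _; apply: x_le1.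
have x0 i : 0 <= x i.
  apply: (@Rle_cv_lim (fun _ => 0) (fun n => u (phi n) i)) => //.
    by move=> n; case: (uP (phi n)).
  by move=> e e0; exists 0%nat => n _; rewrite Rdist_eq.
have x1 : fsum x = 1.
  apply: (UL_sequence _ _ _ (fsum_cv cv)).
  apply: (Un_cv_ext (fun _ => 1)); first by move=> n; case: (uP (phi n)).
  exact: Un_cv_const.
have xt i : rho * x i <= mxvec_mul A x i.
  (* The slack at index [phi n] is weakened to [/ INR n.+1], using [n <= phi n] and [x i <= 1]. *)
  apply: (@Rle_cv_lim (fun n => rho * u (phi n) i - / INR n.+1)
                      (fun n => mxvec_mul A (u (phi n)) i)).
  - move=> n; case: (uP (phi n)) => h0 h1 ht; apply: Rle_trans (ht i).
    have [ui0 ui1] := x_le1 _ h0 h1 i.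
    have le_inv : / INR (phi n).+1 <= / INR n.+1.
      apply: Rinv_le_contravar; first by apply: lt_0_INR; apply/ltP.
      by apply: le_INR; apply/leP; rewrite ltnS.
    have inv0 := inv_INR_gt0 (phi n).
    nra.
  - have -> : rho * x i = rho * x i - 0 by ring.
    apply: CV_minus.
      by apply: CV_mult => //; apply: Un_cv_const.
    exact: inv_INR_cv.
  - apply: fsum_cv => j; by apply: CV_mult => //; apply: Un_cv_const.
pose w j := mxvec_mul A x j - rho * x j.
have w0 i : 0 <= w i by move: (xt i); rewrite /w; lra.
have xp : exists i, 0 < x i by apply: fsum_gt0_ex => //; lra.
case: (classic (exists i, 0 < w i)) => [wp|nwp]; last first.
  have ev j : mxvec_mul A x j = rho * x j.
    apply: NNPP => ne; apply: nwp; exists j; move: (w0 j); rewrite /w; lra.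
  by exists rho, x; split=> //; apply: (eigenvector_gt0 rho0).
(* A nonzero defect [w] would become strictly positive after applying [1 + A]
   often enough, and [rho] could be increased. *)
exfalso.
have [n Hn] := iter_shift_gt0 w0 wp.
pose y := ssrnat.iter n B x.
have y0 i : 0 <= y i by apply: iter_shift_ge0.
have gap i : 0 < mxvec_mul A y i - rho * y i by rewrite -(@iter_shift_defect rho x w).
have [im Him] := ex_argmin t0 (fun i => mxvec_mul A y i - rho * y i).
pose S := fsum y.
have S0 : 0 < S.
  have : 0 <= S by apply: fsum_ge0.
  case=> // S0; exfalso.
  have yz i : y i = 0.
    by apply: Rle_antisym => //; move: (fsum_ge_term i y0); rewrite -/S -S0.
  have : mxvec_mul A y t0 = 0.
    rewrite /mxvec_mul (fsum_eq (g := fun _ => 0)) ?fsum_const; first by ring.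
    by move=> j; rewrite yz; ring.
  by move: (gap t0); rewrite yz; lra.
(* The smallest gap divided by the total mass: as [y i <= S], adding [d] to [rho] costs no
   coordinate more than its gap. *)
pose d := (mxvec_mul A y im - rho * y im) / S.
have d0 : 0 < d by apply: Rdiv_lt_0_compat.
suff : rho + d <= rho by lra.
(* The normalization of [y], written as a combination of two vectors so that [mxvec_mul_lin]
   applies. *)
apply: rho_ub; exists (fun i => / S * y i + 0 * y i).
have iS : 0 < / S by apply: Rinv_0_lt_compat.
split.
- by move=> i; move: (y0 i); nra.
- by rewrite fsumD !fsumMl -/S; field; lra.
move=> i; rewrite mxvec_mul_lin.
have yS : y i <= S by apply: fsum_ge_term.
have dy : d * y i <= mxvec_mul A y i - rho * y i.
  apply: (Rle_trans _ (d * S)); first by apply: Rmult_le_compat_l; lra.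
  by apply: Rle_trans (Him i); rewrite /d; right; field; lra.
have : / S * ((rho + d) * y i) <= / S * mxvec_mul A y i.
  by apply: Rmult_le_compat_l; lra.
lra.
Qed.

End Perron.

Definition transp (T : finType) (A : T -> T -> R) : T -> T -> R := fun i j => A j i.

(** A positive entry of a power of [W] is a walk of positive transitions, along which membership in
    a closed set propagates, from either end. *)
Lemma irreducible_connected (T : finType) (W : T -> T -> R) :
  (forall i j, 0 <= W i j) -> irreducible W -> connected_mx W /\ connected_mx (transp W).
Proof.
move=> W0 irr.
have pow0 n i j : 0 <= matpow W n i j.
  elim: n i j => [|n IH] i j /=; first by case: eqP; lra.
  by apply: fsum_ge0 => k; apply: Rmult_le_pos.
have step n i j : 0 < matpow W n.+1 i j -> exists k, 0 < W i k /\ 0 < matpow W n k j.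
  move=> /fsum_gt0_ex [k|k Hk]; first exact: Rmult_le_pos.
  have {}Hk : 0 < W i k * matpow W n k j by [].
  exists k; move: (W0 i k) (pow0 n k j) => [] h1 [] h2 //.
  - by move: Hk; rewrite -h2 Rmult_0_r; lra.
  - by move: Hk; rewrite -h1 Rmult_0_l; lra.
  - by move: Hk; rewrite -h1 Rmult_0_l; lra.
split; (split; first by move=> i j; apply: W0) => P [a Pa] HP i.
- have [n [_ Hn]] := irr i a.
  elim: n i Hn => [|n IH] i; first by rewrite /=; case: eqP => [->|_ H] //; lra.
  by move=> /step [k [Wik Hk]]; apply: (HP i k) => //; apply: IH.
- have [n [_ Hn]] := irr a i.
  elim: n a Pa Hn => [|n IH] a Pa; first by rewrite /=; case: eqP => [<-|_ H] //; lra.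
  by move=> /step [k [Wak Hk]]; apply: (IH k) => //; apply: (HP k a).
Qed.

(** Pairing any positive right eigenvector with one positive left eigenvector shows that their
    eigenvalues agree. The value chosen by [epsilon] is therefore determined, and it serves both
    sides. *)
Lemma PFeigP (T : finType) (t0 : T) (A : T -> T -> R) :
  connected_mx A -> connected_mx (transp A) ->
  exists u v, [/\ forall i, 0 < u i, forall i, 0 < v i,
    forall j, fsum (fun i => u i * A i j) = PFeig A * u j &
    forall i, fsum (fun j => A i j * v j) = PFeig A * v i].
Proof.
move=> cA cAt.
have [rho [v [v0 Hv]]] := perron_exists cA t0.
have [sig [u [u0 Hu]]] := perron_exists cAt t0.
have {}Hu j : fsum (fun i => u i * A i j) = sig * u j.
  by rewrite -Hu; apply: fsum_eq => i; rewrite /transp; ring.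
have uniq_ rho' v' : (forall i, 0 < v' i) ->
    (forall i, fsum (fun j => A i j * v' j) = rho' * v' i) -> rho' = sig.
  move=> v'0 Hv'.
  have uv0 : 0 < fsum (fun i => u i * v' i).
    apply: (@fsum_gt0 _ _ t0) => [j|]; last exact: Rmult_lt_0_compat.
    by apply: Rmult_le_pos; apply: Rlt_le.
  apply: (Rmult_eq_reg_r (fsum (fun i => u i * v' i))); last lra.
  rewrite -!fsumMl.
  transitivity (fsum (fun i => fsum (fun j => u i * A i j * v' j))).
    apply: fsum_eq => i; rewrite -Rmult_assoc (Rmult_comm rho') Rmult_assoc -Hv' -fsumMl.
    by apply: fsum_eq => j; ring.
  rewrite fsum_exchange; apply: fsum_eq => j.
  by rewrite -Rmult_assoc -Hu -fsumMr.
have [v' [v'0 Hv']] := epsilon_spec (inhabits 0) (fun rho => exists v : T -> R,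
     (forall i, 0 < v i) /\ forall i, fsum (fun j => A i j * v j) = rho * v i)
     (ex_intro _ rho (ex_intro _ v (conj v0 Hv))).
rewrite -/(PFeig A) in Hv'.
have -> : PFeig A = sig by apply: (uniq_ _ _ v'0).
exists u, v; split=> // i; rewrite -(uniq_ _ _ v0 Hv); exact: Hv.
Qed.

(** * Strict convexity of the exponential, from its tangent at the mean *)

Lemma exp_convex l x y : 0 <= l <= 1 ->
  exp (l * x + (1 - l) * y) <= l * exp x + (1 - l) * exp y.
Proof.
move=> l01; set m := _ + _.
have tang z : exp m * (1 + (z - m)) <= exp z.
  have -> : exp z = exp m * exp (z - m) by rewrite -exp_plus; congr exp; ring.
  by apply: Rmult_le_compat_l; [apply/Rlt_le/exp_pos | apply: exp_ineq1_le].
move: (tang x) (tang y) => tx ty.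
have -> : exp m = l * (exp m * (1 + (x - m))) + (1 - l) * (exp m * (1 + (y - m))).
  by rewrite /m; ring.
by apply: Rplus_le_compat; apply: Rmult_le_compat_l => //; lra.
Qed.

Lemma exp_convex_eq l x y : 0 < l < 1 ->
  exp (l * x + (1 - l) * y) = l * exp x + (1 - l) * exp y -> x = y.
Proof.
move=> l01; set m := _ + _ => Heq; apply: NNPP => ne.
have tang z : z <> m -> exp m * (1 + (z - m)) < exp z.
  move=> zm.
  have -> : exp z = exp m * exp (z - m) by rewrite -exp_plus; congr exp; ring.
  by apply: Rmult_lt_compat_l; [apply: exp_pos | apply: exp_ineq1; lra].
have := tang x; have := tang y.
have nx : x <> m by rewrite /m => H; apply: ne; nra.
have ny : y <> m by rewrite /m => H; apply: ne; nra.
move=> /(_ ny) ty /(_ nx) tx.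
have : exp m = l * (exp m * (1 + (x - m))) + (1 - l) * (exp m * (1 + (y - m))).
  by rewrite /m; ring.
have : l * (exp m * (1 + (x - m))) < l * exp x by apply: Rmult_lt_compat_l; lra.
have : (1 - l) * (exp m * (1 + (y - m))) < (1 - l) * exp y by apply: Rmult_lt_compat_l; lra.
lra.
Qed.

(** * Exponentially tilted matrices *)

Definition tilt (T : finType) (W g : T -> T -> R) (theta : R) : T -> T -> R :=
  fun i j => W i j * exp (theta * g i j).

Definition log_pf (T : finType) (W g : T -> T -> R) (theta : R) : R :=
  ln (PFeig (tilt W g theta)).

Section Tilting.

Variables (T : finType) (t0 : T) (W g : T -> T -> R).
Hypotheses (W_conn : connected_mx W) (Wt_conn : connected_mx (transp W)).
Hypothesis W_col : forall j, exists i, 0 < W i j.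

Let W_ge0 i j : 0 <= W i j := W_conn.1 i j.

Lemma tilt_ge0 th i j : 0 <= tilt W g th i j.
Proof. by apply: Rmult_le_pos => //; apply/Rlt_le/exp_pos. Qed.

Lemma tilt_gt0 th i j : 0 < W i j -> 0 < tilt W g th i j.
Proof. by move=> Wij; apply: Rmult_lt_0_compat => //; apply: exp_pos. Qed.

(** The right eigenvector is given by its logarithm [x], ready for exponent arithmetic. [W_col]
    makes the eigenvalue positive, so that [ln] can be inverted. *)
Lemma tilt_perron th : exists u x,
  [/\ forall i, 0 < u i,
      forall j, fsum (fun i => u i * tilt W g th i j) = exp (log_pf W g th) * u j &
      forall i, fsum (fun j => tilt W g th i j * exp (x j)) = exp (log_pf W g th + x i)].
Proof.
have [] := @PFeigP _ t0 (tilt W g th).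
- split=> [|P PE HP]; first exact: tilt_ge0.
  by apply: W_conn.2 => // i j /(tilt_gt0 th); apply: HP.
- split=> [i j|P PE HP]; first exact: tilt_ge0.
  by apply: Wt_conn.2 => // i j /(tilt_gt0 th); apply: HP.
move=> u [v [u0 v0 Hu Hv]].
have rho0 : 0 < PFeig (tilt W g th).
  have [i Wi] := W_col t0.
  apply: (Rmult_lt_reg_r (u t0)); rewrite ?Rmult_0_l // -Hu.
  apply: (@fsum_gt0 _ _ i) => [j|]; last by apply: Rmult_lt_0_compat (tilt_gt0 th Wi).
  by apply: Rmult_le_pos; [apply: Rlt_le | apply: tilt_ge0].
exists u, (fun i => ln (v i)); split=> // [j|i]; first by rewrite /log_pf exp_ln.
rewrite exp_plus /log_pf !exp_ln // -Hv.
by apply: fsum_eq => j; rewrite exp_ln.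
Qed.

Section Convexity.

Variables (l a b : R).
Hypothesis l01 : 0 <= l <= 1.

Let m := l * a + (1 - l) * b.
Let Lm := l * log_pf W g a + (1 - l) * log_pf W g b.

(* The geometric mean of the two Perron eigenvectors is a test vector for the
   tilt at [m]. *)
Lemma tilt_mean : exists x y w : T -> R,
  [/\ forall i, 0 < w i,
      forall i, fsum (fun j => tilt W g m i j * w j) <= exp Lm * w i &
      0 < l < 1 -> forall i,
        fsum (fun j => tilt W g m i j * w j) = exp Lm * w i ->
        forall j, 0 < W i j ->
          a * g i j + x j - log_pf W g a - x i = b * g i j + y j - log_pf W g b - y i].
Proof.
have [_ [x [_ _ Hx]]] := tilt_perron a.
have [_ [y [_ _ Hy]]] := tilt_perron b.
pose w i := exp (l * x i + (1 - l) * y i).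
(* [W i j * exp (p i j)] and [W i j * exp (q i j)] are the Doob transforms of the two tilts and sum
   to 1 over [j]. Their geometric mean gives the tilt at [m]; their arithmetic mean gives the bound
   [rhs]. *)
pose p i j := a * g i j + x j - log_pf W g a - x i.
pose q i j := b * g i j + y j - log_pf W g b - y i.
have lhsE i j : tilt W g m i j * w j =
    exp Lm * w i * (W i j * exp (l * p i j + (1 - l) * q i j)).
  have -> : exp Lm * w i * (W i j * exp (l * p i j + (1 - l) * q i j)) =
      W i j * (exp Lm * exp (l * x i + (1 - l) * y i) * exp (l * p i j + (1 - l) * q i j)).
    by rewrite /w; ring.
  rewrite -!exp_plus /tilt /w Rmult_assoc -exp_plus; congr (_ * exp _).
  by rewrite /p /q /Lm /m; ring.
pose rhs i j := exp Lm * w i * (W i j * (l * exp (p i j) + (1 - l) * exp (q i j))).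
have w0 i : 0 < w i by apply: exp_pos.
have K0 i : 0 < exp Lm * w i by apply: Rmult_lt_0_compat => //; apply: exp_pos.
have le_ij i j : tilt W g m i j * w j <= rhs i j.
  rewrite lhsE; apply: Rmult_le_compat_l; first exact: Rlt_le.
  by apply: Rmult_le_compat_l => //; apply: exp_convex.
have sum1 c z i : (forall i, fsum (fun j => tilt W g c i j * exp (z j)) =
    exp (log_pf W g c + z i)) ->
    fsum (fun j => W i j * exp (c * g i j + z j - log_pf W g c - z i)) = 1.
  move=> Hz; rewrite -exp_0 -(Rplus_opp_r (log_pf W g c + z i)) exp_plus -Hz -fsumMr.
  by apply: fsum_eq => j; rewrite /tilt !Rmult_assoc -!exp_plus; congr (_ * exp _); ring.
have rhs_sum i : fsum (rhs i) = exp Lm * w i.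
  rewrite /rhs fsumMl -[RHS]Rmult_1_r; congr (_ * _).
  transitivity (fsum (fun j => l * (W i j * exp (p i j)) + (1 - l) * (W i j * exp (q i j)))).
    by apply: fsum_eq => j; ring.
  by rewrite fsumD !fsumMl /p /q !sum1 //; ring.
exists x, y, w; split=> // [i|l01' i Heq j Wij].
  by rewrite -rhs_sum; apply: fsum_le.
have := fsum_le_eq (le_ij i); rewrite Heq rhs_sum => /(_ erefl j).
rewrite lhsE /rhs => /Rmult_eq_reg_l => H.
apply: (@exp_convex_eq l) => //.
by apply: (Rmult_eq_reg_l (W i j)); [apply: H; move: (K0 i) | ]; lra.
Qed.

(** The subinvariant vector [w] of [tilt_mean], paired with the positive left eigenvector at [m],
    bounds the eigenvalue. *)
Lemma log_pf_convex : log_pf W g m <= Lm.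
Proof.
have [u [_ [u0 Hu _]]] := tilt_perron m.
have [x [y [w [w0 Hw _]]]] := tilt_mean.
have uw0 : 0 < fsum (fun i => u i * w i).
  apply: (@fsum_gt0 _ _ t0) => [j|]; last exact: Rmult_lt_0_compat.
  by apply: Rmult_le_pos; apply: Rlt_le.
apply: Rnot_lt_le => /exp_increasing lt.
suff : exp (log_pf W g m) * fsum (fun i => u i * w i) <= exp Lm * fsum (fun i => u i * w i).
  move=> /(Rmult_le_reg_r _ _ _ uw0); lra.
rewrite -!fsumMl.
have -> : fsum (fun i => exp (log_pf W g m) * (u i * w i)) =
    fsum (fun i => u i * fsum (fun j => tilt W g m i j * w j)).
  transitivity (fsum (fun j => fsum (fun i => u i * tilt W g m i j * w j))).
    by apply: fsum_eq => j; rewrite -Rmult_assoc -Hu -fsumMr.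
  rewrite fsum_exchange; apply: fsum_eq => i; rewrite -fsumMl.
  by apply: fsum_eq => j; ring.
apply: fsum_le => i.
have -> : exp Lm * (u i * w i) = u i * (exp Lm * w i) by ring.
by apply: Rmult_le_compat_l; [apply: Rlt_le | apply: Hw].
Qed.

(** Equality makes the pairing with the left eigenvector tight in every row, hence the mean
    inequality tight at every positive transition: [g] is then a constant plus a coboundary. *)
Lemma log_pf_convex_eq : 0 < l < 1 -> a <> b -> log_pf W g m = Lm ->
  exists c h, forall i j, 0 < W i j -> g i j = c + h i - h j.
Proof.
move=> l01' ab Leq.
have [u [_ [u0 Hu _]]] := tilt_perron m.
have [x [y [w [w0 Hw Hweq]]]] := tilt_mean.
(* Obtained by solving the entrywise identity of [tilt_mean] for [g i j]. *)
exists ((log_pf W g a - log_pf W g b) / (a - b)), (fun i => (x i - y i) / (a - b)).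
move=> i j Wij.
suff : fsum (fun j => tilt W g m i j * w j) = exp Lm * w i.
  move=> /(Hweq l01' i)/(_ j Wij) H.
  apply: (Rmult_eq_reg_l (a - b)); last lra.
  by transitivity (log_pf W g a - log_pf W g b + (x i - y i) - (x j - y j));
    [lra | field; lra].
apply: (Rmult_eq_reg_l (u i)); last by move: (u0 i); lra.
apply: (@fsum_le_eq _ (fun i => u i * fsum (fun j => tilt W g m i j * w j))
                   (fun i => u i * (exp Lm * w i))).
  by move=> k; apply: Rmult_le_compat_l; [apply: Rlt_le | apply: Hw].
transitivity (fsum (fun j => fsum (fun i => u i * tilt W g m i j * w j))).
  rewrite fsum_exchange; apply: fsum_eq => k; rewrite -fsumMl.
  by apply: fsum_eq => n; ring.
by apply: fsum_eq => k; rewrite fsumMr Hu Leq; ring.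
Qed.

End Convexity.

(** A coboundary only conjugates the matrix by a diagonal one, so tilting multiplies the eigenvalue
    by [exp (c * th)]. Here [w] is the conjugated left eigenvector. *)
Lemma log_pf_affine c h : (forall i j, 0 < W i j -> g i j = c + h i - h j) ->
  forall th, log_pf W g th = log_pf W g 0 + c * th.
Proof.
move=> Hg th.
have [u [_ [u0 Hu _]]] := tilt_perron 0.
have [_ [x [_ _ Hx]]] := tilt_perron th.
pose w i := u i * exp (- (th * h i)).
have w0 i : 0 < w i by apply: Rmult_lt_0_compat => //; apply: exp_pos.
have Hw j : fsum (fun i => w i * tilt W g th i j) = exp (log_pf W g 0 + c * th) * w j.
  rewrite exp_plus.
  have -> : exp (log_pf W g 0) * exp (c * th) * w j =
     exp (log_pf W g 0) * u j * (exp (c * th) * exp (- (th * h j))) by rewrite /w; ring.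
  rewrite -Hu -exp_plus -fsumMr; apply: fsum_eq => i.
  case: (W_ge0 i j) => Wij; last by rewrite /tilt -Wij; ring.
  rewrite /w /tilt Rmult_0_l exp_0.
  transitivity (u i * W i j * (exp (- (th * h i)) * exp (th * g i j))); first by ring.
  by rewrite -exp_plus (Hg _ _ Wij) Rmult_1_r; congr (_ * exp _); ring.
apply: exp_inv.
have wx0 : 0 < fsum (fun i => w i * exp (x i)).
  apply: (@fsum_gt0 _ _ t0) => [j|].
    by apply: Rmult_le_pos; apply: Rlt_le => //; apply: exp_pos.
  by apply: Rmult_lt_0_compat => //; apply: exp_pos.
apply: (Rmult_eq_reg_r (fsum (fun i => w i * exp (x i)))); last lra.
rewrite -!fsumMl.
transitivity (fsum (fun i => fsum (fun j => w i * tilt W g th i j * exp (x j)))).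
  apply: fsum_eq => i; transitivity (w i * exp (log_pf W g th + x i)).
    by rewrite exp_plus; ring.
  by rewrite -Hx -fsumMl; apply: fsum_eq => j; ring.
by rewrite fsum_exchange; apply: fsum_eq => j; rewrite fsumMr Hw; ring.
Qed.

End Tilting.

(** * Sums over words *)

Lemma fsum_tuple0 (T : finType) (f : seq T -> R) :
  fsum (fun s : 0.-tuple T => f s) = f [::].
Proof.
rewrite (fsum_eq (g := fun _ => f [::])) => [|s]; last by rewrite (tuple0 s).
by rewrite fsum_const card_tuple expn0 Rmult_1_l.
Qed.

Lemma fsum_tupleS (T : finType) n (f : seq T -> R) :
  fsum (fun s : n.+1.-tuple T => f s) =
  fsum (fun x => fsum (fun s : n.-tuple T => f (x :: s))).
Proof.
rewrite fsum_pair.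
rewrite -(@fsum_bij _ _ (fun p : T * n.-tuple T => [tuple of p.1 :: p.2])) //.
exists (fun s => (thead s, [tuple of behead s])) => [[x s]|s] /=.
  by congr pair; apply: val_inj.
by apply: val_inj; case/tupleP: s => x s /=; rewrite theadE.
Qed.

Section Words.

Variables (T : finType) (P : T -> R) (A : T -> T -> R).

Lemma chain_prob_ge0 x s : (forall i j, 0 <= A i j) -> 0 <= chain_prob A x s.
Proof.
move=> A0; elim: s x => [|y s IH] x /=; first lra.
exact: Rmult_le_pos.
Qed.

Lemma markov_prob_ge0 s : (forall i, 0 <= P i) -> (forall i j, 0 <= A i j) ->
  0 <= markov_prob P A s.
Proof.
move=> P0 A0; case: s => [|x s] /=; first lra.
by apply: Rmult_le_pos => //; apply: chain_prob_ge0.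
Qed.

Lemma chain_prob_le (A' : T -> T -> R) x s :
  (forall i j, 0 <= A i j <= A' i j) -> chain_prob A x s <= chain_prob A' x s.
Proof.
move=> AA; elim: s x => [|y s IH] x /=; first lra.
have [A0 A1] := AA y x; apply: Rmult_le_compat => //.
by apply: chain_prob_ge0 => i j; case: (AA i j).
Qed.

Lemma markov_prob_le (P' : T -> R) (A' : T -> T -> R) s :
  (forall i, 0 <= P i <= P' i) -> (forall i j, 0 <= A i j <= A' i j) ->
  markov_prob P A s <= markov_prob P' A' s.
Proof.
move=> PP AA; case: s => [|x s] /=; first lra.
have [P0 P1] := PP x; apply: Rmult_le_compat => //; last exact: chain_prob_le.
by apply: chain_prob_ge0 => i j; case: (AA i j).
Qed.

Lemma markov_prob_one s : markov_prob (fun _ : T => 1) (fun _ _ => 1) s = 1.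
Proof.
case: s => //= x s; rewrite Rmult_1_l.
by elim: s x => //= y s IH x; rewrite IH Rmult_1_l.
Qed.

(** Weighting the last letter by a left eigenvector makes the sum over words exactly computable. *)
Lemma chain_eigen_sum (u : T -> R) rho n x :
  (forall j, fsum (fun i => u i * A i j) = rho * u j) ->
  fsum (fun s : n.-tuple T => chain_prob A x s * u (last x s)) = rho ^ n * u x.
Proof.
move=> Hu; elim: n x => [|n IH] x.
  by rewrite (@fsum_tuple0 _ (fun s => chain_prob A x s * u (last x s))).
rewrite (@fsum_tupleS _ n (fun s => chain_prob A x s * u (last x s))) /=.
transitivity (fsum (fun y => rho ^ n * (u y * A y x))); last by rewrite fsumMl Hu; ring.
apply: fsum_eq => y; transitivity (A y x * (rho ^ n * u y)); last ring.
by rewrite -IH -fsumMl; apply: fsum_eq => s; ring.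
Qed.

(** The eigenvector lies between two positive constants, so dropping it from [chain_eigen_sum] costs
    only a bounded factor. *)
Lemma word_sum_bounds (t0 : T) (u : T -> R) L :
  distribution P -> (forall i j, 0 <= A i j) -> (forall i, 0 < u i) ->
  (forall j, fsum (fun i => u i * A i j) = exp L * u j) ->
  exists c C, [/\ 0 < c, 0 < C & forall n,
    c * exp (INR n * L) <= fsum (fun s : n.-tuple T => markov_prob P A s)
      <= C * exp (INR n * L)].
Proof.
move=> [P0 P1] A0 u0 Hu.
have [im Him] := ex_argmin t0 u; have [iM HiM] := ex_argmax t0 u.
set a := u im in Him; set b := u iM in HiM.
have a0 : 0 < a by apply: u0.
have b0 : 0 < b by apply: u0.
have powE n : exp L ^ n = exp (INR n * L).
  elim: n => [|n IH]; first by rewrite Rmult_0_l exp_0.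
  by rewrite S_INR [LHS]/= IH -exp_plus; congr exp; ring.
have chain n x : a / b * exp (INR n * L) <=
    fsum (fun s : n.-tuple T => chain_prob A x s) <= b / a * exp (INR n * L).
  have E0 := exp_pos (INR n * L).
  set S := fsum _.
  have S1 : exp (INR n * L) * u x <= S * b.
    rewrite -powE -(chain_eigen_sum n x Hu) -fsumMr; apply: fsum_le => s.
    by apply: Rmult_le_compat_l => //; apply: chain_prob_ge0.
  have S2 : S * a <= exp (INR n * L) * u x.
    rewrite -powE -(chain_eigen_sum n x Hu) -fsumMr; apply: fsum_le => s.
    by apply: Rmult_le_compat_l => //; apply: chain_prob_ge0.
  have ux1 := Him x; have ux2 := HiM x.
  split.
    apply: (Rmult_le_reg_r b) => //.
    have -> : a / b * exp (INR n * L) * b = exp (INR n * L) * a by field; lra.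
    by apply: Rle_trans S1; apply: Rmult_le_compat_l; lra.
  apply: (Rmult_le_reg_r a) => //.
  have -> : b / a * exp (INR n * L) * a = exp (INR n * L) * b by field; lra.
  by apply: (Rle_trans _ _ _ S2); apply: Rmult_le_compat_l; lra.
have EL := exp_pos (- L).
have ab0 : 0 < a / b * exp (- L) by apply: Rmult_lt_0_compat => //; apply: Rdiv_lt_0_compat.
have ba0 : 0 < b / a * exp (- L) by apply: Rmult_lt_0_compat => //; apply: Rdiv_lt_0_compat.
(* The factor [exp (- L)] accounts for a word having one transition fewer than letters; the
   comparison with 1 covers the empty word. *)
exists (Rmin 1 (a / b * exp (- L))), (Rmax 1 (b / a * exp (- L))); split.
- by apply: Rmin_glb_lt; lra.
- by apply: Rlt_le_trans (Rmax_l _ _); lra.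
case=> [|n].
  rewrite (@fsum_tuple0 _ (markov_prob P A)) /= Rmult_0_l exp_0 !Rmult_1_r.
  by split; [apply: Rmin_l | apply: Rmax_l].
have En : exp (INR n * L) = exp (- L) * exp (INR n.+1 * L).
  by rewrite -exp_plus S_INR; congr exp; ring.
have := exp_pos (INR n.+1 * L); set E := exp (INR n.+1 * L) in En * => E1.
rewrite (@fsum_tupleS _ n (markov_prob P A)) /=.
have sumP c : c = fsum (fun x => P x * c) by rewrite fsumMr P1 Rmult_1_l.
split.
  apply: (Rle_trans _ (a / b * exp (- L) * E)).
    by apply: Rmult_le_compat_r; [lra | apply: Rmin_r].
  rewrite Rmult_assoc -En [X in X <= _]sumP; apply: fsum_le => x; rewrite fsumMl.
  by apply: Rmult_le_compat_l => //; case: (chain n x).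
apply: (Rle_trans _ (b / a * exp (- L) * E)); last first.
  by apply: Rmult_le_compat_r; [lra | apply: Rmax_r].
rewrite Rmult_assoc -En [X in _ <= X]sumP; apply: fsum_le => x; rewrite fsumMl.
by apply: Rmult_le_compat_l => //; case: (chain n x).
Qed.

End Words.

(** * Additive weights of words *)

Fixpoint path_weight (T : finType) (g : T -> T -> R) (prev : T) (s : seq T) : R :=
  match s with
  | [::] => 0
  | x :: s' => g x prev + path_weight g x s'
  end.

(** The first letter has no weight, so that tilting leaves the initial law alone. *)
Definition word_weight (T : finType) (g : T -> T -> R) (s : seq T) : R :=
  match s with
  | [::] => 0
  | x :: s' => path_weight g x s'
  end.

Lemma markov_prob_tilt (T : finType) (P : T -> R) (W g : T -> T -> R) theta s :
  markov_prob P (tilt W g theta) s = markov_prob P W s * exp (theta * word_weight g s).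
Proof.
case: s => [|x s] /=; first by rewrite Rmult_0_r exp_0; ring.
rewrite Rmult_assoc; congr (_ * _).
elim: s x => [|y s IH] x /=; first by rewrite Rmult_0_r exp_0; ring.
by rewrite IH Rmult_plus_distr_l exp_plus /tilt; ring.
Qed.

(** * A change of measure bound on the error probability *)

Section ChangeOfMeasure.

Variables (Om : finType) (p G : Om -> R) (D : pred Om).
Hypothesis p_ge0 : forall o, 0 <= p o.

(* The outcomes with [G < A] or [B < G] are discarded by exponential Chebyshev
   bounds, the correctly decoded ones by the bound on their total weight at
   the tilt [1]. *)
Lemma error_change_of_measure theta s A B : 0 < theta < 1 -> 0 < s ->
  fsum (fun o => p o * exp (theta * G o))
    - exp (s * A) * fsum (fun o => p o * exp ((theta - s) * G o))
    - exp (- s * B) * fsum (fun o => p o * exp ((theta + s) * G o))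
    - exp (- (1 - theta) * A) * fsum (fun o => if D o then p o * exp (1 * G o) else 0)
  <= exp (theta * B) * fsum (fun o => p o * (if D o then 0 else 1)).
Proof.
(* The inequality holds outcome by outcome: in each case below, a single term already dominates
   [exp (theta * G o)]. *)
move=> th01 s0; rewrite -!fsumMl -!fsumB; apply: fsum_le => o.
have reorder x y : exp x * (p o * exp y) = p o * exp (x + y) by rewrite exp_plus; ring.
have -> : exp (- (1 - theta) * A) * (if D o then p o * exp (1 * G o) else 0) =
    p o * (if D o then exp (- (1 - theta) * A + 1 * G o) else 0).
  by case: (D o); rewrite ?reorder //; ring.
rewrite !reorder -Rmult_assoc (Rmult_comm (exp _) (p o)) Rmult_assoc.
rewrite -!Rmult_minus_distr_l; apply: Rmult_le_compat_l => //.
have exp_mono x y : x <= y -> exp x <= exp y.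
  by case=> [/exp_increasing|->]; [exact: Rlt_le | exact: Rle_refl].
have e1 := exp_pos (s * A + (theta - s) * G o).
have e2 := exp_pos (- s * B + (theta + s) * G o).
have e3 : 0 <= if D o then exp (- (1 - theta) * A + 1 * G o) else 0.
  by case: (D o); [apply/Rlt_le/exp_pos | lra].
have e4 : 0 <= exp (theta * B) * (if D o then 0 else 1).
  by apply: Rmult_le_pos; [apply/Rlt_le/exp_pos | case: (D o); lra].
case: (Rlt_le_dec (G o) A) => GA.
  suff : exp (theta * G o) <= exp (s * A + (theta - s) * G o) by lra.
  by apply: exp_mono; nra.
case: (Rlt_le_dec B (G o)) => GB.
  suff : exp (theta * G o) <= exp (- s * B + (theta + s) * G o) by lra.
  by apply: exp_mono; nra.
move: e3 e4; case: (D o) => e3 e4.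
  suff : exp (theta * G o) <= exp (- (1 - theta) * A + 1 * G o) by lra.
  by apply: exp_mono; nra.
suff : exp (theta * G o) <= exp (theta * B) by lra.
by apply: exp_mono; nra.
Qed.

End ChangeOfMeasure.

(** * Codes for the conditional additive channel *)

(** For a fixed input word, output and noise correspond bijectively, letter by letter. *)
Lemma fsum_noise (X : finZmodType) (Z : finType) n (f : seq (X * Z) -> R)
    (xt : n.-tuple X) :
  fsum (fun y : n.-tuple (X * Z) => f (noise_of y xt)) =
  fsum (fun w : n.-tuple (X * Z) => f w).
Proof.
rewrite /noise_of; set h := fun p : X * Z * X => _.
elim: n f xt => [|n IH] f xt.
  by apply: fsum_eq => y; rewrite (tuple0 y) (tuple0 xt).
case/tupleP: xt => x xt.
rewrite (@fsum_tupleS _ n (fun y => f [seq h p | p <- zip y (x :: xt)])) fsum_tupleS /=.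
transitivity (fsum (fun y => fsum (fun w : n.-tuple (X * Z) => f (h (y, x) :: w)))).
  by apply: fsum_eq => y; rewrite (IH (fun w => f (h (y, x) :: w))).
rewrite (@fsum_bij _ _ (fun y => h (y, x))
   (fun y => fsum (fun w : n.-tuple (X * Z) => f (y :: w)))) //.
exists (fun y => (GRing.add y.1 x, y.2)) => [[y z]|[y z]]; rewrite /h /=.
  by rewrite GRing.subrK.
by rewrite GRing.addrK.
Qed.

(** Subtracting the input changes only the [X] components, which this weight does not see. *)
Lemma markov_prob_noise (X : finZmodType) (Z : finType) (q : Z -> R) (Q : Z -> Z -> R)
    n (y : n.-tuple (X * Z)) (xt : n.-tuple X) :
  markov_prob (fun p => q p.2) (fun p p' => Q p.2 p'.2) (noise_of y xt) =
  markov_prob (fun p => q p.2) (fun p p' => Q p.2 p'.2) y.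
Proof.
have sz : size y = size xt by rewrite !size_tuple.
rewrite /noise_of; move: (tval y) (tval xt) sz => {y xt} [|y s] [|x t] //= [sz].
congr (_ * _).
elim: s t y x sz => [|y' s IH] [|x' t] //= y x [sz].
by congr (_ * _); rewrite (IH t y' x').
Qed.

(** * Convex functions *)

Section ConvexTangent.

Variables (U : R -> R) (t0 dU : R).
Hypothesis U_convex : forall l a b, 0 <= l <= 1 ->
  U (l * a + (1 - l) * b) <= l * U a + (1 - l) * U b.
Hypothesis U_deriv : derivable_pt_lim U t0 dU.

(** The derivative as a first-order expansion, free of division and valid at [h = 0]. *)
Lemma deriv_remainder eps : 0 < eps -> exists d, 0 < d /\
  forall h, Rabs h < d -> Rabs (U (t0 + h) - U t0 - dU * h) <= eps * Rabs h.
Proof.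
move=> e0; have [d Hd] := U_deriv e0; exists d; split=> [|h hd]; first exact: cond_pos.
case: (Req_dec h 0) => [->|h0].
  by rewrite Rplus_0_r Rmult_0_r !Rminus_diag Rabs_R0; lra.
have := Hd h h0 hd => lt.
have -> : U (t0 + h) - U t0 - dU * h = ((U (t0 + h) - U t0) / h - dU) * h by field.
by rewrite Rabs_mult; apply: Rmult_le_compat_r; [apply: Rabs_pos | apply: Rlt_le].
Qed.

(** A point lying [gap] below the tangent would, by convexity, put the point at fraction [l] of the
    way at least [l * gap] below it, whereas differentiability allows at most half of that for small
    [l]. *)
Lemma convex_above_tangent t : U t0 + dU * (t - t0) <= U t.
Proof.
apply: Rnot_lt_le => lt.
pose gap := U t0 + dU * (t - t0) - U t.
have gap0 : 0 < gap by rewrite /gap; lra.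
case: (Req_dec t t0) => [tt|tt]; first by move: lt; rewrite tt; lra.
have d0 : 0 < Rabs (t - t0) by apply: Rabs_pos_lt; lra.
have e0 : 0 < gap / 2 / Rabs (t - t0) by apply: Rdiv_lt_0_compat => //; lra.
have [d [dpos Hd]] := deriv_remainder e0.
pose l := Rmin 1 (d / 2 / Rabs (t - t0)).
have l0 : 0 < l.
  by apply: Rmin_glb_lt; [lra | apply: Rdiv_lt_0_compat => //; lra].
have l1 : l <= 1 by apply: Rmin_l.
have ld : l * Rabs (t - t0) <= d / 2.
  apply: (Rle_trans _ (d / 2 / Rabs (t - t0) * Rabs (t - t0))).
    by apply: Rmult_le_compat_r; [lra | apply: Rmin_r].
  by right; field; lra.
have absl : Rabs (l * (t - t0)) = l * Rabs (t - t0).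
  by rewrite Rabs_mult (Rabs_pos_eq l) //; lra.
have := Hd (l * (t - t0)); rewrite absl => /(_ ltac:(lra)).
have -> : gap / 2 / Rabs (t - t0) * (l * Rabs (t - t0)) = l * (gap / 2) by field; lra.
have := @U_convex l t t0 (conj (Rlt_le _ _ l0) l1).
have -> : l * t + (1 - l) * t0 = t0 + l * (t - t0) by ring.
move=> cvx rem.
have lg : 0 < l * gap by apply: Rmult_lt_0_compat.
have := Rle_abs (- (U (t0 + l * (t - t0)) - U t0 - dU * (l * (t - t0)))).
rewrite Rabs_Ropp => rem2.
have : l * gap = l * U t0 + dU * (l * (t - t0)) - l * U t by rewrite /gap; ring.
lra.
Qed.

Hypothesis U_rigid : forall l a b, 0 < l < 1 -> a <> b ->
  U (l * a + (1 - l) * b) = l * U a + (1 - l) * U b ->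
  exists c0 c1, forall t, U t = c0 + c1 * t.

(** If [U] touched its tangent at another point, convexity would be an equality at the midpoint. By
    rigidity [U] would be affine, hence equal to the tangent, which [t1] excludes. *)
Lemma convex_above_tangent_strict t1 t : U t0 + dU * (t1 - t0) < U t1 -> t <> t0 ->
  U t0 + dU * (t - t0) < U t.
Proof.
move=> lt1 ne; apply: Rnot_le_lt => le.
have eqt : U t = U t0 + dU * (t - t0) by apply: Rle_antisym => //; apply: convex_above_tangent.
have [|||c0 [c1 aff]] := @U_rigid (1 / 2) t t0 => //; first lra.
  apply: Rle_antisym; first by apply: U_convex; lra.
  by apply: Rle_trans (convex_above_tangent _); rewrite eqt; lra.
have c1E : c1 = dU.
  apply: (Rmult_eq_reg_r (t - t0)); last lra.
  by move: eqt; rewrite !aff; lra.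
by move: lt1; rewrite !aff c1E; lra.
Qed.

(* The parameters of the change of measure: with [theta] slightly above [t0] and
   [s = theta - t0], [a] and [b] are the slopes of the chords of [U] to the left
   and to the right of [theta], moved apart by a small [d]. *)
Lemma exponent_parameters Rt : 0 < t0 < 1 -> (1 - t0) * dU + U t0 = Rt -> Rt < U 1 ->
  forall eps, 0 < eps -> exists theta s a b gamma,
    [/\ 0 < theta < 1, 0 < s, 0 < gamma, theta * b - U theta <= t0 * dU - U t0 + eps &
      [/\ s * a + U (theta - s) <= U theta - gamma,
          - s * b + U (theta + s) <= U theta - gamma &
          Rt - (1 - theta) * a <= U theta - gamma]].
Proof.
move=> t01 RtE RtU eps e0.
have [d [d0 Hd]] := @deriv_remainder (eps / 8) ltac:(lra).
(* Small enough for the expansion to hold at [t0 + 2 * h] and for [t0 + h] to stay below 1. *)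
pose h := Rmin (d / 4) ((1 - t0) / 2).
have h0 : 0 < h by apply: Rmin_glb_lt; lra.
have hd : h <= d / 4 by apply: Rmin_l.
have ht : h <= (1 - t0) / 2 by apply: Rmin_r.
(* [Rt] is the value at 1 of the tangent at [t0], so [Rt < U 1] supplies the point strictly above
   it. *)
have strict : U t0 + dU * h < U (t0 + h).
  have := @convex_above_tangent_strict 1 (t0 + h) ltac:(lra) ltac:(lra).
  by have -> : t0 + h - t0 = h by ring.
have := Hd (h + h); rewrite Rabs_pos_eq; last lra.
move=> /(_ ltac:(lra)) rem2.
have {}rem2 := Rle_trans _ _ _ (Rle_abs _) rem2.
pose D := (U (t0 + h) - U t0) / h.
pose b0 := (U (t0 + (h + h)) - U (t0 + h)) / h.
have hD : h * D = U (t0 + h) - U t0 by rewrite /D; field; lra.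
have hb : h * b0 = U (t0 + (h + h)) - U (t0 + h) by rewrite /b0; field; lra.
have DdU : dU < D by apply: (Rmult_lt_reg_l h) => //; lra.
have b0_le : b0 <= dU + eps / 4 by apply: (Rmult_le_reg_l h) => //; lra.
have K0 : 0 < (1 - t0) * (D - dU) by apply: Rmult_lt_0_compat; lra.
(* The first two inequalities get slack exactly [h * del]. The third has slack [(1 - t0) * (D - dU)]
   before [del] enters, of which [del] consumes at most half. *)
pose del := Rmin (eps / 4) ((1 - t0) * (D - dU) / 2).
have del0 : 0 < del by apply: Rmin_glb_lt; lra.
have del1 : del <= eps / 4 by apply: Rmin_l.
have del2 : del <= (1 - t0) * (D - dU) / 2 by apply: Rmin_r.
have hdel : 0 < h * del by apply: Rmult_lt_0_compat.
exists (t0 + h), h, (D - del), (b0 + del), (Rmin (h * del) ((1 - t0) * (D - dU) / 2)).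
split; [lra | lra | by apply: Rmin_glb_lt; lra | |].
  have : (t0 + h) * (b0 + del) <= (t0 + h) * (dU + eps / 2).
    by apply: Rmult_le_compat_l; lra.
  have : (t0 + h) * (eps / 2) <= 1 * (eps / 2) by apply: Rmult_le_compat_r; lra.
  lra.
have m1 := Rmin_l (h * del) ((1 - t0) * (D - dU) / 2).
have m2 := Rmin_r (h * del) ((1 - t0) * (D - dU) / 2).
split.
- have -> : t0 + h - h = t0 by ring.
  by lra.
- have -> : t0 + h + h = t0 + (h + h) by ring.
  by lra.
have : (1 - (t0 + h)) * del <= 1 * del by apply: Rmult_le_compat_r; lra.
by nra.
Qed.

(** With [Rt] written through the tangent, the upper bound at each [t < 1] is the tangent
    inequality, and it is attained at [t0]. *)
Lemma tangent_lub Rt : 0 < t0 < 1 -> (1 - t0) * dU + U t0 = Rt ->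
  is_lub (fun y => exists t, t < 1 /\ y = (t * Rt - U t) / (1 - t)) (t0 * dU - U t0).
Proof.
move=> t01 RtE; split=> [y [t [t1 ->]]|b Hb].
  apply: (Rmult_le_reg_r (1 - t)); first lra.
  have -> : (t * Rt - U t) / (1 - t) * (1 - t) = t * Rt - U t by field; lra.
  by rewrite -RtE; move: (convex_above_tangent t); lra.
by apply: Hb; exists t0; split; [lra | rewrite -RtE; field; lra].
Qed.

End ConvexTangent.

(** * Exponential decay and integer parts *)

Lemma eventually_exp_small c C gamma : 0 < c -> 0 < gamma ->
  exists N : nat, forall n : nat, (N <= n)%nat -> C * exp (- (INR n * gamma)) <= c.
Proof.
move=> c0 g0.
have [N HN] := INR_archimed _ (Rabs C / c) g0.
exists N => n Nn.
have h1 : Rabs C / c <= exp (INR n * gamma).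
  apply: (Rle_trans _ (1 + INR n * gamma)); last exact: exp_ineq1_le.
  have : INR N * gamma <= INR n * gamma.
    by apply: Rmult_le_compat_r; [lra | apply: le_INR; apply/leP].
  by lra.
have E0 := exp_pos (- (INR n * gamma)).
apply: (Rle_trans _ (Rabs C * exp (- (INR n * gamma)))).
  by apply: Rmult_le_compat_r; [lra | apply: Rle_abs].
have -> : Rabs C = Rabs C / c * c by field; lra.
have E1 : exp (INR n * gamma) * exp (- (INR n * gamma)) = 1.
  by rewrite -exp_plus Rplus_opp_r exp_0.
have : Rabs C / c * exp (- (INR n * gamma)) <= 1.
  by rewrite -E1; apply: Rmult_le_compat_r; lra.
by nra.
Qed.

Lemma floorRP x : 0 <= x -> INR (floorR x) <= x < INR (floorR x) + 1.
Proof.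
move=> x0; have [h1 h2] := base_Int_part x.
have z0 : (0 <= Int_part x)%Z.
  by apply/Z.lt_succ_r; apply: lt_IZR; rewrite succ_IZR; lra.
by rewrite /floorR INR_IZR_INZ Z2Nat.id //; lra.
Qed.

(** * Source and channel *)

(** There are finitely many codes, so the minimum that [Pj] selects by [epsilon] exists. Codes are
    counted as finite functions and transferred by extensionality; [m0] provides a first decoder. *)
Lemma code_error_min (M : finType) (X : finZmodType) (Z : finType)
  (PM1 : M -> R) (Ws : M -> M -> R) (PXZ1 : (X * Z)%type -> R)
  (Wc : (X * Z)%type -> (X * Z)%type -> R) (m0 : M) k n :
  exists (e : k.-tuple M -> n.-tuple X) (d : n.-tuple (X * Z) -> k.-tuple M),
    Pj PM1 Ws PXZ1 Wc k n = code_error PM1 Ws PXZ1 Wc e d.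
Proof.
pose f (c : {ffun k.-tuple M -> n.-tuple X} * {ffun n.-tuple (X * Z) -> k.-tuple M}) :=
  code_error PM1 Ws PXZ1 Wc c.1 c.2.
have [[e d] Hmin] := @ex_argmin _
  ([ffun _ => [tuple of nseq n GRing.zero]], [ffun _ => [tuple of nseq k m0]]) f.
have [|[e' [d' He]] _] := epsilon_spec (inhabits 0) (fun p =>
    (exists e d, code_error PM1 Ws PXZ1 Wc (k:=k) (n:=n) e d = p) /\
    (forall e d, p <= code_error PM1 Ws PXZ1 Wc (k:=k) (n:=n) e d)).
  exists (f (e, d)); split=> [|e' d']; first by exists e, d.
  have -> : e' = finfun e' by apply: functional_extensionality => x; rewrite ffunE.
  have -> : d' = finfun d' by apply: functional_extensionality => x; rewrite ffunE.
  exact: (Hmin (finfun e', finfun d')).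
by exists e', d'; rewrite He.
Qed.

(** Information density of a source transition. Its value at zero transitions is a convention,
    harmless because [tilt] multiplies by [Ws m m']. *)
Definition src_dens (M : finType) (Ws : M -> M -> R) (m m' : M) : R := - ln (Ws m m').

(** Conditional information density of the [X] component given the [Z] component, for one
    transition. *)
Definition noise_dens (X : finZmodType) (Z : finType)
    (Wc : (X * Z)%type -> (X * Z)%type -> R) (p p' : (X * Z)%type) : R :=
  ln (WcZ Wc p.2 p'.2) - ln (Wc p p').

Lemma rpow0_exp a t : 0 <= a -> rpow0 a (1 - t) = a * exp (t * - ln a).
Proof.
rewrite /rpow0; case: Rlt_dec => [a0 _|na a0]; last first.
  have aE : a = 0 by apply: Rle_antisym => //; apply: Rnot_lt_le.
  by rewrite /= {1}aE Rmult_0_l.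
by rewrite /Rpower /= -{2}(exp_ln a) // -exp_plus; congr exp; ring.
Qed.

Lemma thetaHs_log_pf (M : finType) (Ws : M -> M -> R) t : (forall m m', 0 <= Ws m m') ->
  thetaHs Ws t = log_pf Ws (src_dens Ws) t.
Proof.
move=> W0; rewrite /thetaHs /log_pf; congr (ln (PFeig _)).
apply: functional_extensionality => m; apply: functional_extensionality => m'.
exact: rpow0_exp.
Qed.

Lemma stochastic_col (T : finType) (W : T -> T -> R) : stochastic W ->
  forall j, exists i, 0 < W i j.
Proof.
by move=> [W0 W1] j; apply: fsum_gt0_ex => //; rewrite W1; lra.
Qed.

Section Channel.

Variables (X : finZmodType) (Z : finType) (Wc : (X * Z)%type -> (X * Z)%type -> R).
Hypotheses (Wc_stoch : stochastic Wc) (Wc_ass1 : assumption1 Wc).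

Let Wc_ge0 p p' : 0 <= Wc p p' := Wc_stoch.1 p p'.

(** [WcZ] fixes the previous [X] letter to zero; Assumption 1 allows any other. *)
Lemma WcZE z z' x' : WcZ Wc z z' = fsum (fun x : X => Wc (x, z) (x', z')).
Proof. exact: Wc_ass1. Qed.

Lemma le_WcZ p p' : Wc p p' <= WcZ Wc p.2 p'.2.
Proof.
case: p p' => [x z] [x' z'] /=; rewrite (WcZE _ _ x').
by apply: (@fsum_ge_term _ (fun x => Wc (x, z) (x', z'))) => j; apply: Wc_ge0.
Qed.

(** [WcZ] is stochastic on [Z], and each [z] is counted once per element of [X]. *)
Lemma fsum_WcZ (p' : (X * Z)%type) : 
  fsum (fun p : (X * Z)%type => WcZ Wc p.2 p'.2) = INR #|X|.
Proof.
case: p' => [x' z'] /=.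
rewrite -(fsum_pair (fun (_ : X) z => WcZ Wc z z')). rewrite fsum_const.
rewrite -[RHS]Rmult_1_r; congr (_ * _).
rewrite -(Wc_stoch.2 (x', z')).
transitivity (fsum (fun x => fsum (fun z => Wc (x, z) (x', z')))).
  by rewrite fsum_exchange; apply: fsum_eq => z; apply: WcZE.
rewrite (@fsum_pair X Z (fun x z => Wc (x, z) (x', z'))).
by apply: fsum_eq => -[].
Qed.

Lemma thetaHc_log_pf t : thetaHc Wc t = log_pf Wc (noise_dens Wc) t.
Proof.
rewrite /thetaHc /log_pf; congr (ln (PFeig _)).
apply: functional_extensionality => p; apply: functional_extensionality => p'.
rewrite rpow0_exp; last exact: Wc_ge0.
case: (Wc_ge0 p p') => W0; last by rewrite /tilt -W0; ring.
have WZ0 := Rlt_le_trans _ _ _ W0 (le_WcZ p p').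
rewrite /rpow0; case: Rlt_dec => [_ /=|] //.
by rewrite /Rpower /tilt /noise_dens Rmult_assoc -exp_plus; congr (_ * exp _); ring.
Qed.

(** At the tilt 1 a positive transition of [Wc] becomes that of [WcZ], while a zero one stays
    zero. *)
Lemma tilt1_noise_dens p p' : 0 <= tilt Wc (noise_dens Wc) 1 p p' <= WcZ Wc p.2 p'.2.
Proof.
split.
  by apply: Rmult_le_pos; [apply: Wc_ge0 | apply/Rlt_le/exp_pos].
case: (Wc_ge0 p p') => W0; rewrite /tilt; last first.
  by rewrite -W0 Rmult_0_l [X in X <= _]W0; apply: le_WcZ.
have WZ0 := Rlt_le_trans _ _ _ W0 (le_WcZ p p').
rewrite /noise_dens Rmult_1_l /Rminus exp_plus exp_Ropp !exp_ln //.
rewrite (Rmult_comm (WcZ _ _ _)) -Rmult_assoc Rinv_r ?Rmult_1_l; first exact: Rle_refl.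
exact: Rgt_not_eq.
Qed.

End Channel.

Lemma tilt1_src_dens (M : finType) (Ws : M -> M -> R) m m' :
  0 <= Ws m m' -> 0 <= tilt Ws (src_dens Ws) 1 m m' <= 1.
Proof.
move=> [W0|W0]; rewrite /tilt; last by rewrite -W0 Rmult_0_l; lra.
by rewrite /src_dens Rmult_1_l exp_Ropp exp_ln // Rinv_r; lra.
Qed.

Lemma distribution_le1 (T : finType) (P : T -> R) i : distribution P -> 0 <= P i <= 1.
Proof. by move=> [P0 P1]; split=> //; rewrite -P1; apply: fsum_ge_term. Qed.

(** * Lower bound on the error probability of joint source-channel codes *)

Section Converse.

Variables (M : finType) (X : finZmodType) (Z : finType).
Variables (PM1 : M -> R) (Ws : M -> M -> R).
Variables (PXZ1 : (X * Z)%type -> R) (Wc : (X * Z)%type -> (X * Z)%type -> R) (r : R).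
Hypotheses (PM1_distr : distribution PM1) (Ws_stoch : stochastic Ws)
  (Ws_irr : irreducible Ws).
Hypotheses (PXZ1_distr : distribution PXZ1) (Wc_stoch : stochastic Wc)
  (Wc_irr : irreducible Wc) (Wc_ass1 : assumption1 Wc).
Hypothesis r0 : 0 < r.

Local Notation gs := (src_dens Ws).
Local Notation gc := (noise_dens Wc).
Local Notation U := (Ufun Ws Wc r).
Local Notation blk n := (floorR (r * INR n)).

Let inhabM : exists m : M, 0 < PM1 m.
Proof. by apply: fsum_gt0_ex; [exact: PM1_distr.1 | rewrite PM1_distr.2; lra]. Qed.

Let inhabXZ : exists p, 0 < PXZ1 p.
Proof. by apply: fsum_gt0_ex; [exact: PXZ1_distr.1 | rewrite PXZ1_distr.2; lra]. Qed.

Let UE t : U t = r * log_pf Ws gs t + log_pf Wc gc t.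
Proof.
rewrite /Ufun thetaHs_log_pf ?thetaHc_log_pf //; exact: Ws_stoch.1.
Qed.

Lemma Ufun_convex l a b : 0 <= l <= 1 ->
  U (l * a + (1 - l) * b) <= l * U a + (1 - l) * U b.
Proof.
move=> l01; rewrite !UE.
have [m0 _] := inhabM; have [p0 _] := inhabXZ.
have [cs cst] := irreducible_connected Ws_stoch.1 Ws_irr.
have [cc cct] := irreducible_connected Wc_stoch.1 Wc_irr.
have := log_pf_convex m0 gs cs cst (stochastic_col Ws_stoch) a b l01.
have := log_pf_convex p0 gc cc cct (stochastic_col Wc_stoch) a b l01.
by nra.
Qed.

(** Both summands are convex and [r] is positive, so equality for [U] forces equality for each of
    them, and each is then affine. *)
Lemma Ufun_rigid l a b : 0 < l < 1 -> a <> b ->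
  U (l * a + (1 - l) * b) = l * U a + (1 - l) * U b ->
  exists c0 c1, forall t, U t = c0 + c1 * t.
Proof.
move=> l01 ab; rewrite !UE => Heq.
have [m0 _] := inhabM; have [p0 _] := inhabXZ.
have [cs cst] := irreducible_connected Ws_stoch.1 Ws_irr.
have [cc cct] := irreducible_connected Wc_stoch.1 Wc_irr.
have l01' : 0 <= l <= 1 by lra.
have colS := stochastic_col Ws_stoch; have colC := stochastic_col Wc_stoch.
have les := log_pf_convex m0 gs cs cst colS a b l01'.
have lec := log_pf_convex p0 gc cc cct colC a b l01'.
have eqs : log_pf Ws gs (l * a + (1 - l) * b) =
    l * log_pf Ws gs a + (1 - l) * log_pf Ws gs b by nra.
have eqc : log_pf Wc gc (l * a + (1 - l) * b) =
    l * log_pf Wc gc a + (1 - l) * log_pf Wc gc b by nra.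
have [c [h Hg]] := log_pf_convex_eq m0 cs cst colS l01' l01 ab eqs.
have [c' [h' Hg']] := log_pf_convex_eq p0 cc cct colC l01' l01 ab eqc.
exists (r * log_pf Ws gs 0 + log_pf Wc gc 0), (r * c + c') => t.
rewrite UE (log_pf_affine m0 cs cst colS Hg) (log_pf_affine p0 cc cct colC Hg').
by ring.
Qed.

(** The total weight at the tilt [t]; [code_partition] shows that it is the same for every code. *)
Definition partition_sum t n :=
  fsum (fun m : (blk n).-tuple M => markov_prob PM1 (tilt Ws gs t) m) *
  fsum (fun w : n.-tuple (X * Z) => markov_prob PXZ1 (tilt Wc gc t) w).

Lemma partition_bounds t : exists c C, [/\ 0 < c, 0 < C &
  forall n, c * exp (INR n * U t) <= partition_sum t n <= C * exp (INR n * U t)].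
Proof.
have [m0 _] := inhabM; have [p0 _] := inhabXZ.
have [cs cst] := irreducible_connected Ws_stoch.1 Ws_irr.
have [cc cct] := irreducible_connected Wc_stoch.1 Wc_irr.
have [u [_ [u0 Hu _]]] := tilt_perron m0 gs cs cst (stochastic_col Ws_stoch) t.
have [v [_ [v0 Hv _]]] := tilt_perron p0 gc cc cct (stochastic_col Wc_stoch) t.
have [c1 [C1 [c10 C10 H1]]] := word_sum_bounds m0 PM1_distr (tilt_ge0 gs cs t) u0 Hu.
have [c2 [C2 [c20 C20 H2]]] := word_sum_bounds p0 PXZ1_distr (tilt_ge0 gc cc t) v0 Hv.
set L1 := log_pf Ws gs t in Hu H1; set L2 := log_pf Wc gc t in Hv H2.
(* The price of rounding [r * INR n] down to an integer, an error of less than 1. *)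
pose K := exp (Rabs L1).
have K0 : 0 < K by apply: exp_pos.
have blk_exp n : / K * exp (r * INR n * L1) <= exp (INR (blk n) * L1)
    <= K * exp (r * INR n * L1).
  have rn0 : 0 <= r * INR n by apply: Rmult_le_pos; [lra | apply: pos_INR].
  have [f1 f2] := floorRP rn0.
  have exp_mono x y : x <= y -> exp x <= exp y.
    by case=> [/exp_increasing|->]; [exact: Rlt_le | exact: Rle_refl].
  have a1 := Rle_abs L1; have a2 := Rle_abs (- L1); rewrite Rabs_Ropp in a2.
  by rewrite /K -exp_Ropp -!exp_plus; split; apply: exp_mono; nra.
exists (c1 * / K * c2), (C1 * K * C2).
have iK0 : 0 < / K by apply: Rinv_0_lt_compat.
split; [by repeat apply: Rmult_lt_0_compat | by repeat apply: Rmult_lt_0_compat |].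
move=> n.
have -> : exp (INR n * U t) = exp (r * INR n * L1) * exp (INR n * L2).
  by rewrite -exp_plus UE; congr exp; rewrite /L1 /L2; ring.
have [b1 b2] := blk_exp n; have [s1 s2] := H1 (blk n); have [w1 w2] := H2 n.
rewrite /partition_sum; set S1 := fsum _ in s1 s2 *; set S2 := fsum _ in w1 w2 *.
have e1 := exp_pos (r * INR n * L1); have e2 := exp_pos (INR n * L2).
have e3 := exp_pos (INR (blk n) * L1).
set E1 := exp (r * INR n * L1) in b1 b2 e1 *; set E2 := exp (INR n * L2) in w1 w2 e2 *.
set E3 := exp (INR (blk n) * L1) in b1 b2 e3 s1 s2.
have S1lo : c1 * (/ K * E1) <= S1.
  by apply: Rle_trans s1; apply: Rmult_le_compat_l; lra.
have S1hi : S1 <= C1 * (K * E1).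
  by apply: (Rle_trans _ _ _ s2); apply: Rmult_le_compat_l; lra.
have p1 : 0 < c1 * (/ K * E1) by repeat apply: Rmult_lt_0_compat.
have p2 : 0 < c2 * E2 by repeat apply: Rmult_lt_0_compat.
split.
  have -> : c1 * / K * c2 * (E1 * E2) = c1 * (/ K * E1) * (c2 * E2) by ring.
  by apply: Rmult_le_compat; lra.
have -> : C1 * K * C2 * (E1 * E2) = C1 * (K * E1) * (C2 * E2) by ring.
by apply: Rmult_le_compat; lra.
Qed.

Section Code.

Variables (k n : nat) (e : k.-tuple M -> n.-tuple X) (d : n.-tuple (X * Z) -> k.-tuple M).

Definition code_prob (o : k.-tuple M * n.-tuple (X * Z)) :=
  markov_prob PM1 Ws o.1 * markov_prob PXZ1 Wc (noise_of o.2 (e o.1)).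
Definition code_dens (o : k.-tuple M * n.-tuple (X * Z)) :=
  word_weight gs o.1 + word_weight gc (noise_of o.2 (e o.1)).

Lemma code_prob_tilt t o : code_prob o * exp (t * code_dens o) =
  markov_prob PM1 (tilt Ws gs t) o.1 *
  markov_prob PXZ1 (tilt Wc gc t) (noise_of o.2 (e o.1)).
Proof. by rewrite !markov_prob_tilt /code_prob /code_dens Rmult_plus_distr_l exp_plus; ring. Qed.

(** For each message, the sum over outputs is a sum over noise words and no longer depends on the
    codeword. *)
Lemma code_partition t : fsum (fun o => code_prob o * exp (t * code_dens o)) =
  fsum (fun m : k.-tuple M => markov_prob PM1 (tilt Ws gs t) m) *
  fsum (fun w : n.-tuple (X * Z) => markov_prob PXZ1 (tilt Wc gc t) w).
Proof.
rewrite (fsum_eq (code_prob_tilt t)) -(fsum_pair (fun (m : k.-tuple M)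
  (y : n.-tuple (X * Z)) => markov_prob PM1 (tilt Ws gs t) m *
  markov_prob PXZ1 (tilt Wc gc t) (noise_of y (e m)))) -fsumMr.
apply: fsum_eq => m; rewrite fsumMl; congr (_ * _).
exact: (fsum_noise (markov_prob PXZ1 (tilt Wc gc t))).
Qed.

Lemma code_errorE : code_error PM1 Ws PXZ1 Wc e d =
  fsum (fun o => code_prob o * (if d o.2 == o.1 then 0 else 1)).
Proof. by rewrite /code_error fsum_pair. Qed.

(* At the tilt [1] the weight of [(m, y)] is at most the [Z]-marginal weight of
   [y], and each [y] is decoded to a single message. *)
Lemma code_correct_weight :
  fsum (fun o => if d o.2 == o.1 then code_prob o * exp (1 * code_dens o) else 0) <=
  fsum (fun y : n.-tuple (X * Z) =>
    markov_prob (fun _ => 1) (fun p p' => WcZ Wc p.2 p'.2) y).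
Proof.
set q := fun y : n.-tuple (X * Z) => markov_prob _ _ y.
(* The message factor is at most 1, and the noise factor is at most the [Z]-marginal weight [q],
   which is unchanged by the shift with the codeword. *)
apply: (Rle_trans _ (fsum (fun o => if d o.2 == o.1 then q o.2 else 0))).
  apply: fsum_le => o; case: (d o.2 == o.1); last lra.
  rewrite code_prob_tilt -[q _]Rmult_1_l; apply: Rmult_le_compat.
  - apply: markov_prob_ge0 => [i|i j]; first exact: PM1_distr.1.
    by case: (@tilt1_src_dens _ Ws i j (Ws_stoch.1 i j)).
  - apply: markov_prob_ge0 => [i|i j]; first exact: PXZ1_distr.1.
    by case: (tilt1_noise_dens Wc_stoch Wc_ass1 i j).
  - rewrite -[X in _ <= X](markov_prob_one o.1); apply: markov_prob_le => [i|i j].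
      exact: distribution_le1.
    by apply: tilt1_src_dens; apply: Ws_stoch.1.
  - rewrite /q -(@markov_prob_noise X Z (fun _ => 1) (WcZ Wc) n o.2 (e o.1)).
    apply: markov_prob_le => [i|i j]; first exact: distribution_le1.
    exact: tilt1_noise_dens.
rewrite -(fsum_pair (fun (m : k.-tuple M) y => if d y == m then q y else 0)) fsum_exchange.
by right; apply: fsum_eq => y; rewrite (fsum_pred1 (fun _ => q y)).
Qed.

End Code.

(** The constant vector is a left eigenvector of the [WcZ] matrix on pairs, with eigenvalue
    [INR #|X|]. *)
Lemma output_weight_bound : exists C, 0 < C /\ forall n,
  fsum (fun y : n.-tuple (X * Z) =>
    markov_prob (fun _ => 1) (fun p p' => WcZ Wc p.2 p'.2) y) <=
  C * exp (INR n * ln (INR #|X|)).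
Proof.
have X0 : 0 < INR #|X|.
  by apply: lt_0_INR; apply/ltP; apply/card_gt0P; exists GRing.zero.
have powE n : exp (INR n * ln (INR #|X|)) = INR #|X| ^ n.
  elim: n => [|n IH]; first by rewrite Rmult_0_l exp_0.
  by rewrite S_INR Rmult_plus_distr_r Rmult_1_l exp_plus IH exp_ln //=; ring.
have Z1 : 1 <= INR #|Z|.
  have [[x z] _] := inhabXZ.
  by apply: (le_INR 1); apply/leP; apply/card_gt0P; exists z.
(* The first letter has weight 1 and [#|X| * #|Z|] possible values, which leaves a factor [#|Z|]
   beyond the power of [#|X|]. *)
exists (INR #|Z|); split=> [|n]; first lra.
rewrite powE; case: n => [|n].
  by rewrite (@fsum_tuple0 _ (markov_prob _ _)) /= Rmult_1_r.
rewrite (@fsum_tupleS _ n (markov_prob _ _)) /=.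
right; transitivity (fsum (fun _ : X * Z => INR #|X| ^ n)).
  apply: fsum_eq => y; rewrite -[RHS]Rmult_1_r.
  rewrite -(@chain_eigen_sum _ (fun p p' => WcZ Wc p.2 p'.2) (fun _ => 1) _ n y).
    by apply: fsum_eq => s; rewrite Rmult_1_l Rmult_1_r.
  move=> j; rewrite Rmult_1_r -(fsum_WcZ Wc_stoch Wc_ass1 j).
  by apply: fsum_eq => i; rewrite Rmult_1_l.
by rewrite fsum_const card_prod mult_INR (Rmult_comm (INR #|X|)) Rmult_assoc.
Qed.

(** The last three inequalities make the three discarded weights in [error_change_of_measure], taken
    at [A = n * a] and [B = n * b], smaller than the total tilted weight by a factor of order
    [exp (- n * gamma)]. *)
Lemma Pj_lower_bound theta s a b gamma : 0 < theta < 1 -> 0 < s -> 0 < gamma ->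
  s * a + U (theta - s) <= U theta - gamma ->
  - s * b + U (theta + s) <= U theta - gamma ->
  ln (INR #|X|) - (1 - theta) * a <= U theta - gamma ->
  exists c N, 0 < c /\ forall n, (N <= n)%nat ->
    c * exp (- (INR n * (theta * b - U theta))) <= Pj PM1 Ws PXZ1 Wc (blk n) n.
Proof.
move=> th01 s0 g0 Ha Hb Hc.
have [m0 _] := inhabM.
have [c [C0 [c0 _ Hlo]]] := partition_bounds theta.
have [c1 [C1 [_ C10 H1]]] := partition_bounds (theta - s).
have [c2 [C2 [_ C20 H2]]] := partition_bounds (theta + s).
have [C3 [C30 H3]] := output_weight_bound.
(* From [N] on, the discarded weights take away at most half of the lower bound on the total. *)
have [N HN] := @eventually_exp_small (c / 2) (C1 + C2 + C3) gamma ltac:(lra) g0.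
exists (c / 2), N; split=> [|n /HN {}HN]; first lra.
have [e [d ->]] := code_error_min PM1 Ws PXZ1 Wc m0 (blk n) n.
have p0 o : 0 <= code_prob e o.
  by apply: Rmult_le_pos; apply: markov_prob_ge0 => [i|i j];
    [exact: PM1_distr.1 | exact: Ws_stoch.1 | exact: PXZ1_distr.1 | exact: Wc_stoch.1].
have := error_change_of_measure (code_dens e) (fun o => d o.2 == o.1) p0
  (INR n * a) (INR n * b) th01 s0.
rewrite -code_errorE !code_partition -/(partition_sum theta n) -/(partition_sum (theta - s) n)
  -/(partition_sum (theta + s) n).
have := code_correct_weight e d; set Cor := fsum _ => HCor main.
have exp_mono x y : x <= y -> exp x <= exp y.
  by case=> [/exp_increasing|->]; [exact: Rlt_le | exact: Rle_refl].
have n0 := pos_INR n.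
have discard x y S C : 0 < C -> S <= C * exp (INR n * y) -> x + y <= U theta - gamma ->
    exp (INR n * x) * S <= C * (exp (INR n * U theta) * exp (- (INR n * gamma))).
  move=> Cp SC xy.
  apply: (Rle_trans _ (exp (INR n * x) * (C * exp (INR n * y)))).
    by apply: Rmult_le_compat_l => //; apply/Rlt_le/exp_pos.
  have -> : exp (INR n * x) * (C * exp (INR n * y)) = C * exp (INR n * (x + y)).
    by rewrite Rmult_plus_distr_l exp_plus; ring.
  apply: Rmult_le_compat_l; first lra.
  by rewrite -exp_plus; apply: exp_mono; nra.
have d1 := discard _ _ _ _ C10 (proj2 (H1 n)) Ha.
have d2 := discard _ _ _ _ C20 (proj2 (H2 n)) Hb.
have Hc' : - (1 - theta) * a + ln (INR #|X|) <= U theta - gamma by lra.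
have d3 := discard _ _ _ _ C30 (Rle_trans _ _ _ HCor (H3 n)) Hc'.
move: main.
have -> : s * (INR n * a) = INR n * (s * a) by ring.
have -> : - s * (INR n * b) = INR n * (- s * b) by ring.
have -> : - (1 - theta) * (INR n * a) = INR n * (- (1 - theta) * a) by ring.
have -> : theta * (INR n * b) = INR n * (theta * b) by ring.
have := proj1 (Hlo n); set E := exp (INR n * U theta) in d1 d2 d3 * => lo main.
have E0 : 0 < E by apply: exp_pos.
have small : (C1 + C2 + C3) * exp (- (INR n * gamma)) * E <= c / 2 * E.
  by apply: Rmult_le_compat_r; lra.
have key : c / 2 * E <= exp (INR n * (theta * b)) * code_error PM1 Ws PXZ1 Wc e d by lra.
have F0 := exp_pos (INR n * (theta * b)).
apply: (Rmult_le_reg_l (exp (INR n * (theta * b)))) => //.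
apply: Rle_trans key; right.
rewrite /E -Rmult_assoc (Rmult_comm _ (c / 2)) Rmult_assoc -exp_plus.
by congr (_ * exp _); ring.
Qed.

Lemma Pj_exponent theta0 dU : U 1 > ln (INR #|X|) -> 0 < theta0 < 1 ->
  derivable_pt_lim U theta0 dU -> (1 - theta0) * dU + U theta0 = ln (INR #|X|) ->
  forall eps, 0 < eps -> exists N : nat, forall n : nat, (N <= n)%nat ->
     0 < Pj PM1 Ws PXZ1 Wc (blk n) n /\
     - (1 / INR n) * ln (Pj PM1 Ws PXZ1 Wc (blk n) n) <= theta0 * dU - U theta0 + eps.
Proof.
move=> RU th0 Hd Heq eps e0.
have e2 : 0 < eps / 2 by lra.
(* Half of [eps] pays for moving from [theta0] to [theta]; the other half absorbs the constant [c],
   whose logarithm is divided by [n]. *)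
have [theta [s [a [b [gamma [th01 s0 g0 Hth [Ha Hb Hc]]]]]]] :=
  exponent_parameters Ufun_convex Hd Ufun_rigid th0 Heq RU e2.
have [c [N [c0 HN]]] := Pj_lower_bound th01 s0 g0 Ha Hb Hc.
have [N' HN'] := INR_archimed _ (- ln c) e2.
exists (maxn 1 (maxn N N')) => n; rewrite !geq_max => /andP[n1 /andP[Nn N'n]].
have {}HN := HN n Nn.
have n0 : 0 < INR n by apply: lt_0_INR; apply/ltP.
have X0 := exp_pos (- (INR n * (theta * b - U theta))).
have lo0 : 0 < c * exp (- (INR n * (theta * b - U theta))) by apply: Rmult_lt_0_compat.
have P0 := Rlt_le_trans _ _ _ lo0 HN.
split=> //.
have lnP : ln c - INR n * (theta * b - U theta) <= ln (Pj PM1 Ws PXZ1 Wc (blk n) n).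
  have -> : ln c - INR n * (theta * b - U theta) =
      ln (c * exp (- (INR n * (theta * b - U theta)))) by rewrite ln_mult // ln_exp.
  by case: HN => [/(ln_increasing _ _ lo0)/Rlt_le|->] //; lra.
apply: (Rmult_le_reg_l (INR n)) => //.
have -> : INR n * (- (1 / INR n) * ln (Pj PM1 Ws PXZ1 Wc (blk n) n)) =
  - ln (Pj PM1 Ws PXZ1 Wc (blk n) n) by field; lra.
have N'le : INR N' <= INR n by apply: le_INR; apply/leP.
have : INR N' * (eps / 2) <= INR n * (eps / 2) by apply: Rmult_le_compat_r; lra.
have : INR n * (theta * b - U theta) <= INR n * (theta0 * dU - U theta0 + eps / 2).
  by apply: Rmult_le_compat_l; lra.
lra.
Qed.

End Converse.

Theorem mainTheorem13 (M : finType) (X : finZmodType) (Z : finType)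
  (PM1 : M -> R) (Ws : M -> M -> R)
  (PXZ1 : (X * Z)%type -> R) (Wc : (X * Z)%type -> (X * Z)%type -> R)
  (r theta0 dU : R) :
  distribution PM1 -> stochastic Ws -> irreducible Ws -> aperiodic Ws ->
  distribution PXZ1 -> stochastic Wc -> irreducible Wc -> aperiodic Wc ->
  assumption1 Wc ->
  0 < r ->
  r * Hs Ws + Hc Wc < ln (INR #|X|) ->
  ln (INR #|X|) < r * Hs0 Ws + Hc0 Wc ->
  0 < theta0 < 1 ->
  derivable_pt_lim (Ufun Ws Wc r) theta0 dU ->
  (1 - theta0) * dU + Ufun Ws Wc r theta0 = ln (INR #|X|) ->
  (forall eps, 0 < eps -> exists N : nat, forall n : nat, (N <= n)%nat ->
     0 < Pj PM1 Ws PXZ1 Wc (floorR (r * INR n)) n /\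
     - (1 / INR n) * ln (Pj PM1 Ws PXZ1 Wc (floorR (r * INR n)) n)
       <= theta0 * dU - Ufun Ws Wc r theta0 + eps)
  /\
  is_lub (fun y => exists theta, theta < 1 /\
            y = (theta * ln (INR #|X|) - Ufun Ws Wc r theta) / (1 - theta))
         (theta0 * dU - Ufun Ws Wc r theta0).
Proof.
move=> dM sW iW _ dXZ sWc iWc _ ass1 r0 _ RU th0 Hd Heq; split.
  exact: (Pj_exponent dM sW iW dXZ sWc iWc ass1 r0).
exact: (tangent_lub (Ufun_convex dM sW iW dXZ sWc iWc ass1 r0) Hd).
Qed.
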